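(* Let $L$ be an even lattice, and let $R$ be a commutative ring. If $\det L$ is invertible in $R$, then the formula $\omega=\sum_{i,j}\frac{(G^{-1})_{i,j}}{2}\alpha_i(-1)\alpha_j(-1)\mathbf 1$ (where $\{\alpha_i\}$ is a basis of $L$ with Gram matrix $G$) defines a conformal vector $\omega$ that endows $V_{L,R}$ with the structure of a vertex operator algebra over $R$.
   Context: Vertex algebras. A vertex algebra over a commutative ring $R$ is an $R$-module $V$ with a vector $\mathbf 1\in V$ and an $R$-linear map $Y:V\otimes_R V\to V((z))$, $a\otimes b\mapsto Y(a,z)b=\sum_{n\in\mathbb Z}a_nb\,z^{-n-1}$, such that $Y(\mathbf 1,z)=\mathrm{id}_V z^0$, $Y(a,z)\mathbf 1\in a+zV[[z]]$, and for all $r,s,t\in\mathbb Z$, $u,v,w\in V$, $\sum_{i\ge 0}\binom{r}{i}(u_{t+i}v)_{r+s-i}w=\sum_{i\ge0}(-1)^i\binom{t}{i}\bigl(u_{r+t-i}(v_{s+i}w)-(-1)^t v_{s+t-i}(u_{r+i}w)\bigr)$. It is $\mathbb Z$-graded if $V=\bigoplus_n V_n$ with $u_nv\in V_{k+m-n-1}$ for $u\in V_k$, $v\in V_m$. A vertex operator algebra over $R$ of central half-charge $c\in R$ is a $\mathbb Z$-graded vertex algebra with a vector $\omega$ (the conformal vector), $Y(\omega,z)=\sum_i L_iz^{-i-2}$, such that $L_0$ acts diagonalizably with integer eigenvalues, $L_0v=nv$ for $v\in V_n$, there is some $N\in\mathbb Z$ with $V_n=0$ for $n<N$, each $V_n$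 is a finite type projective $R$-module, $L_{-1}u=u_{-2}\mathbf 1$ for all $u$, and $[L_m,L_n]=(m-n)L_{m+n}+\delta_{m+n,0}\binom{m+1}{3}c\,\mathrm{id}_V$. Lattice vertex algebra. An even lattice is a finitely generated free abelian group $L$ with a nondegenerate integer-valued symmetric bilinear form $(\cdot,\cdot)$ with all $(a,a)$ even; $\det L$ is the determinant of a Gram matrix. Let $\hat L$ be the central extension of $L$ by $\{1,\kappa\}\cong\{\pm1\}$ with commutator $\kappa^{(\bar a,\bar b)}$, with a set-theoretic section $a\mapsto e_a$ ($e_0=1$). The twisted group ring is $\mathbb Z\{L\}=\mathbb Z[\hat L]/(\kappa+1)$, with $\mathbb Z$-basis $\iota(e_a)$, $a\in L$. Put $\pi^L_{0,\mathbb Q}=\mathrm{Sym}_{\mathbb Q}(t^{-1}(L\otimes\mathbb Q)[t^{-1}])$ and $V_{L,\mathbb Q}=\mathbb Q\{L\}\otimes\pi^L_{0,\mathbb Q}=\bigoplus_{a\in L}\pi^L_{a,\mathbb Q}$, where $\pi^L_{a,\mathbb Q}=\iota(e_a)\otimes \pi^L_{0,\mathbb Q}$. For $b\in L\otimes\mathbb Q$, $b(n)$ acts by multiplication by $bt^n$ if $n<0$, by $(b,a)$ on $\pi^L_{a,\mathbb Q}$ if $n=0$, and for $n>0$ by the derivation killing each $\iota(e_a)$ with $[b(m),a(n)]=m(b,a)\delta_{m+n,0}$. $V_{L,\mathbb Q}$ has the unique $\mathbb Q$-vertex algebra structure with identity $\iota(e_0)\otimes1$, $Y(b(-1)\mathbf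 1,z)=\sum_n b(n)z^{-n-1}$, and $Y(\iota(e_a),z)=\exp(\sum_{n>0}\frac{a(-n)}{n}z^n)\exp(-\sum_{n>0}\frac{a(n)}{n}z^{-n})\,\iota(e_a)z^a$, where $z^a$ acts as $z^{(a,b)}$ on $\pi^L_{b,\mathbb Q}$. The degree of $b_1(-n_1)\cdots b_k(-n_k)\iota(e_a)$ is $\sum n_i+(a,a)/2$. Let $s_{a,n}$ be the $z^n$-coefficient of $\exp(-\sum_{m>0}\frac{a(-m)}{m}z^m)$. $V_L$ is the $\mathbb Z$-span of all $s_{a^1,n_1}\cdots s_{a^k,n_k}\iota(e_a)$, $a^i,a\in L$, $n_i\ge0$; it is a $\mathbb Z$-graded vertex algebra over $\mathbb Z$. Put $V_{L,R}=V_L\otimes R$. Interpretation of the formula over $R$: $\omega=\sum_i\frac{(G^{-1})_{i,i}}{2}\alpha_i(-1)^2\mathbf 1+\sum_{i<j}(G^{-1})_{i,j}\alpha_i(-1)\alpha_j(-1)\mathbf 1$, whose coefficients lie in $\mathbb Z[1/\det L]$ and are mapped to $R$.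
   Formalization: For an even lattice that is not positive definite, the grading of V_{L,R} (R nonzero) is not bounded below, so the claim fails; the full vertex operator algebra structure is asserted for positive definite L, and all axioms but boundedness and finite type projectivity for every even L. *)

(* Defs.v *)
From HB Require Import structures.
From mathcomp Require Import all_boot all_order all_algebra.
From mathcomp Require Import generic_quotient.
From mathcomp Require Import finmap multiset.
From mathcomp Require Import monalg boolp.

Set Implicit Arguments.
Unset Strict Implicit.
Unset Printing Implicit Defensive.

Import GRing.Theory.

Local Open Scope ring_scope.
Local Open Scope mset_scope.
Local Open Scope quotient_scope.

Definition binz (r : int) (i : nat) : int :=
  ((\prod_(j < i) (r - j%:Z)) %/ (i`!)%:Z)%Z.

Definition signz (t : int) : int := (-1) ^+ `|t|%N.

Section VertexAlgebras.

Context {R : comPzRingType} {V : lmodType R}.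

Definition submodule (P : V -> Prop) : Prop :=
  P 0 /\ forall (a : R) u v, P u -> P v -> P (a *: u + v).

Definition finitely_generated (P : V -> Prop) : Prop :=
  exists s : seq V, (forall x, x \in s -> P x) /\
    forall v, P v -> exists c : nat -> R, v = \sum_(i < size s) c i *: s`_i.

Definition linear_on (M : lmodType R) (P : V -> Prop) (f : V -> M) : Prop :=
  forall (a : R) u v, P u -> P v -> f (a *: u + v) = a *: f u + f v.

(* Maps out of the submodule [P] are represented by maps on [V] that are
   linear on [P]; their values outside [P] are irrelevant. *)
Definition projective (P : V -> Prop) : Prop :=
  forall (M N : lmodType R) (g : {linear M -> N}) (f : V -> N),
    (forall y, exists x, g x = y) -> linear_on P f ->
    exists2 h : V -> M, linear_on P h & forall v, P v -> g (h v) = f v.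

Definition direct_sum (gr : int -> V -> Prop) : Prop :=
  [/\ forall k, submodule (gr k),
      forall v, exists (s : seq int) (f : int -> V),
        (forall k, gr k (f k)) /\ v = \sum_(k <- s) f k
    & forall (s : seq int) (f : int -> V), uniq s -> (forall k, gr k (f k)) ->
        \sum_(k <- s) f k = 0 -> forall k, k \in s -> f k = 0].

(* [Y k u v] is the product u_k v.  Because of [va_trunc] the two sums of the
   Borcherds identity are finite, so each is the value of all its long enough
   partial sums. *)
Record vertex_algebra (vac : V) (Y : int -> V -> V -> V) : Prop := {
  va_linl : forall k v a u u', Y k (a *: u + u') v = a *: Y k u v + Y k u' v;
  va_linr : forall k u a v v', Y k u (a *: v + v') = a *: Y k u v + Y k u v';
  va_trunc : forall u v, exists N : int,
    forall k : int, (N <= k)%R -> Y k u v = 0;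
  va_vac : forall k v, Y k vac v = if k == -1 then v else 0;
  va_create0 : forall u, Y (-1) u vac = u;
  va_create : forall u (k : nat), Y k u vac = 0;
  va_borcherds : forall (r s t : int) u v w, exists N0 : nat,
    forall N : nat, (N0 <= N)%N ->
    \sum_(i < N) Y (r + s - i%:Z) (Y (t + i%:Z) u v) w *~ binz r i
    = \sum_(i < N)
        (Y (r + t - i%:Z) u (Y (s + i%:Z) v w)
         - Y (s + t - i%:Z) v (Y (r + i%:Z) u w) *~ signz t)
        *~ ((-1) ^+ i * binz t i) }.

Record graded_vertex_algebra (vac : V) (Y : int -> V -> V -> V)
    (gr : int -> V -> Prop) : Prop := {
  gva_va : vertex_algebra vac Y;
  gva_sum : direct_sum gr;
  gva_prod : forall (k m j : int) u v,
    gr k u -> gr m v -> gr (k + m - j - 1) (Y j u v) }.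

(* Y(omega, z) = \sum_i L_i z^(-i-2), that is L_i = omega_(i+1). *)
Definition vir (Y : int -> V -> V -> V) (omega : V) (i : int) : V -> V :=
  Y (i + 1) omega.

Definition diagonalizable_int (f : V -> V) : Prop :=
  forall v, exists s : seq (int * V),
    (forall p, p \in s -> f p.2 = p.1%:~R *: p.2) /\ v = \sum_(p <- s) p.2.

(* All axioms of a vertex operator algebra of central half-charge [c] except
   the finiteness conditions on the graded pieces, which hold for the lattice
   vertex algebra of an even lattice (over a nonzero ring) only when the
   lattice is positive definite. *)
Record conformal_vertex_algebra (vac : V) (Y : int -> V -> V -> V)
    (gr : int -> V -> Prop) (omega : V) (c : R) : Prop := {
  cva_gva : graded_vertex_algebra vac Y gr;
  cva_diag : diagonalizable_int (vir Y omega 0);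
  cva_deg : forall k v, gr k v -> vir Y omega 0 v = k%:~R *: v;
  cva_trans : forall u, vir Y omega (-1) u = Y (-2) u vac;
  cva_vir : forall (m k : int) v,
    vir Y omega m (vir Y omega k v) - vir Y omega k (vir Y omega m v)
    = (m - k)%:~R *: vir Y omega (m + k) v
      + (if m + k == 0 then ((binz (m + 1) 3)%:~R * c) *: v else 0) }.

Record vertex_operator_algebra (vac : V) (Y : int -> V -> V -> V)
    (gr : int -> V -> Prop) (omega : V) (c : R) : Prop := {
  voa_cva : conformal_vertex_algebra vac Y gr omega c;
  voa_bounded : exists N : int,
    forall k, (k < N)%R -> forall v, gr k v -> v = 0;
  voa_fg : forall k, finitely_generated (gr k);
  voa_proj : forall k, projective (gr k) }.

End VertexAlgebras.

Section BaseChange.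

Context (R : comPzRingType) (V : zmodType).

Inductive tens_rel : seq (V * R) -> seq (V * R) -> Prop :=
| tens_refl s : tens_rel s s
| tens_sym s t : tens_rel s t -> tens_rel t s
| tens_trans s t w : tens_rel s t -> tens_rel t w -> tens_rel s w
| tens_cat s s' t t' :
    tens_rel s s' -> tens_rel t t' -> tens_rel (s ++ t) (s' ++ t')
| tens_comm s t : tens_rel (s ++ t) (t ++ s)
| tens_zero r : tens_rel [:: (0, r)] [::]
| tens_addl u v r : tens_rel [:: (u + v, r)] [:: (u, r); (v, r)]
| tens_addr v r s : tens_rel [:: (v, r + s)] [:: (v, r); (v, s)].

Definition tens_eq (s t : seq (V * R)) : bool := `[< tens_rel s t >].

Lemma tens_eq_refl : reflexive tens_eq.
Proof. by move=> s; apply/asboolP/tens_refl. Qed.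

Lemma tens_eq_sym : symmetric tens_eq.
Proof. by move=> s t; apply/asboolP/asboolP; apply: tens_sym. Qed.

Lemma tens_eq_trans : transitive tens_eq.
Proof.
move=> t s w /asboolP st /asboolP tw; apply/asboolP; exact: tens_trans tw.
Qed.

Canonical tens_equiv := EquivRel tens_eq tens_eq_refl tens_eq_sym tens_eq_trans.

(* The tensor product of V and R over the integers: formal sums of pure
   tensors modulo the congruence generated by biadditivity. *)
Definition tensor := {eq_quot tens_equiv}.

HB.instance Definition _ := EqQuotient.on tensor.
HB.instance Definition _ := Choice.on tensor.

Definition tens_class (s : seq (V * R)) : tensor := \pi_tensor s.

Lemma tens_classP s t : tens_class s = tens_class t <-> tens_rel s t.
Proof.
split=> [/eqmodP /asboolP //|st]; apply/eqmodP/asboolP; exact: st.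
Qed.

Lemma tens_classK x : tens_class (repr x) = x.
Proof. exact: reprK. Qed.

Lemma tens_ind (P : tensor -> Prop) :
  (forall s, P (tens_class s)) -> forall x, P x.
Proof. by move=> Ps x; rewrite -(tens_classK x). Qed.

Lemma repr_class s : tens_rel (repr (tens_class s)) s.
Proof. by apply/tens_classP; rewrite tens_classK. Qed.

Definition scale_formal (a : R) (s : seq (V * R)) : seq (V * R) :=
  [seq (p.1, a * p.2) | p <- s].

Definition opp_formal (s : seq (V * R)) : seq (V * R) :=
  [seq (- p.1, p.2) | p <- s].

Lemma scale_formal_rel a s t :
  tens_rel s t -> tens_rel (scale_formal a s) (scale_formal a t).
Proof.
elim=> {s t}; rewrite /scale_formal.
- by move=> s; apply: tens_refl.
- by move=> s t _; apply: tens_sym.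
- by move=> s t w _ st _; apply: tens_trans.
- by move=> s s' t t' _ H _ K; rewrite !map_cat; apply: tens_cat.
- by move=> s t; rewrite !map_cat; apply: tens_comm.
- by move=> r; apply: tens_zero.
- by move=> u v r; apply: tens_addl.
- by move=> v r s /=; rewrite mulrDr; apply: tens_addr.
Qed.

Lemma opp_formal_rel s t :
  tens_rel s t -> tens_rel (opp_formal s) (opp_formal t).
Proof.
elim=> {s t}; rewrite /opp_formal.
- by move=> s; apply: tens_refl.
- by move=> s t _; apply: tens_sym.
- by move=> s t w _ st _; apply: tens_trans.
- by move=> s s' t t' _ H _ K; rewrite !map_cat; apply: tens_cat.
- by move=> s t; rewrite !map_cat; apply: tens_comm.
- by move=> r /=; rewrite oppr0; apply: tens_zero.
- by move=> u v r /=; rewrite opprD; apply: tens_addl.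
- by move=> v r s /=; apply: tens_addr.
Qed.

Definition tens_add (x y : tensor) := tens_class (repr x ++ repr y).
Definition tens_opp (x : tensor) := tens_class (opp_formal (repr x)).
Definition tens_scale (a : R) (x : tensor) :=
  tens_class (scale_formal a (repr x)).

Lemma tens_addE s t :
  tens_add (tens_class s) (tens_class t) = tens_class (s ++ t).
Proof. by apply/tens_classP/tens_cat; apply: repr_class. Qed.

Lemma tens_oppE s : tens_opp (tens_class s) = tens_class (opp_formal s).
Proof. by apply/tens_classP/opp_formal_rel/repr_class. Qed.

Lemma tens_scaleE a s :
  tens_scale a (tens_class s) = tens_class (scale_formal a s).
Proof. by apply/tens_classP/scale_formal_rel/repr_class. Qed.

Lemma tens_addA : associative tens_add.
Proof.
elim/tens_ind=> s; elim/tens_ind=> t; elim/tens_ind=> w.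
by rewrite !tens_addE catA.
Qed.

Lemma tens_addC : commutative tens_add.
Proof.
elim/tens_ind=> s; elim/tens_ind=> t; rewrite !tens_addE.
by apply/tens_classP/tens_comm.
Qed.

Lemma tens_add0 : left_id (tens_class [::]) tens_add.
Proof. by elim/tens_ind=> s; rewrite tens_addE. Qed.

Lemma tens_addN : left_inverse (tens_class [::]) tens_opp tens_add.
Proof.
elim/tens_ind=> s; rewrite tens_oppE tens_addE; apply/tens_classP.
elim: s => [|[v r] s IH] /=; first exact: tens_refl.
rewrite -[_ :: _ ++ _]/([:: (- v, r)] ++ (opp_formal s ++ ([:: (v, r)] ++ s))).
apply: (@tens_trans _ (([:: (- v, r)] ++ [:: (v, r)]) ++ (opp_formal s ++ s))).
  rewrite -catA; apply: tens_cat; first exact: tens_refl.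
  by rewrite !catA; apply: tens_cat; [apply: tens_comm | apply: tens_refl].
rewrite -[[::]]/([::] ++ [::]); apply: tens_cat; last exact: IH.
apply: (tens_trans (tens_sym (tens_addl (- v) v r))); rewrite addNr.
exact: tens_zero.
Qed.

HB.instance Definition _ :=
  GRing.isZmodule.Build tensor tens_addA tens_addC tens_add0 tens_addN.

Lemma tens_classD s t : tens_class (s ++ t) = tens_class s + tens_class t.
Proof. by rewrite -tens_addE. Qed.

Lemma tens_scaleA a b x : tens_scale a (tens_scale b x) = tens_scale (a * b) x.
Proof.
elim/tens_ind: x => s; rewrite !tens_scaleE; congr tens_class.
by rewrite /scale_formal -map_comp; apply: eq_map => p /=; rewrite mulrA.
Qed.

Lemma tens_scale1 : left_id 1 tens_scale.
Proof.
elim/tens_ind=> s; rewrite tens_scaleE; congr tens_class.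
by rewrite /scale_formal -[RHS]map_id; apply: eq_map => -[v r] /=; rewrite mul1r.
Qed.

Lemma tens_scaleDr : right_distributive tens_scale +%R.
Proof.
move=> a; elim/tens_ind=> s; elim/tens_ind=> t.
by rewrite -tens_classD !tens_scaleE -tens_classD /scale_formal map_cat.
Qed.

Lemma tens_scaleDl x : {morph tens_scale^~ x : a b / a + b}.
Proof.
move=> a b; elim/tens_ind: x => s; rewrite !tens_scaleE.
elim: s => [|[v r] s IH] /=; first by rewrite -tens_classD.
rewrite -[_ :: _]cat1s -[X in _ = tens_class X + _]cat1s.
rewrite -[X in _ = _ + tens_class X]cat1s !tens_classD IH mulrDl.
have -> : tens_class [:: (v, a * r + b * r)]
          = tens_class [:: (v, a * r)] + tens_class [:: (v, b * r)].
  by rewrite -tens_classD; apply/tens_classP/tens_addr.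
by rewrite addrACA.
Qed.

HB.instance Definition _ := GRing.Zmodule_isLmodule.Build R tensor
  tens_scaleA tens_scale1 tens_scaleDr tens_scaleDl.

Definition tens (v : V) (r : R) : tensor := tens_class [:: (v, r)].

(* The R-bilinear extension (u \otimes r, v \otimes s) |-> f u v \otimes r s. *)
Definition tens_prod (f : V -> V -> V) (x y : tensor) : tensor :=
  \sum_(p <- repr x) \sum_(q <- repr y) tens (f p.1 q.1) (p.2 * q.2).

Lemma tensDl u v r : tens (u + v) r = tens u r + tens v r.
Proof. by rewrite /tens -tens_classD; apply/tens_classP/tens_addl. Qed.

Lemma tensDr v r s : tens v (r + s) = tens v r + tens v s.
Proof. by rewrite /tens -tens_classD; apply/tens_classP/tens_addr. Qed.

Lemma tens0 r : tens 0 r = 0.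
Proof. exact/tens_classP/tens_zero. Qed.

Lemma sum_tens_rel (M : zmodType) (h : V -> R -> M) :
  (forall u v r, h (u + v) r = h u r + h v r) ->
  (forall v r s, h v (r + s) = h v r + h v s) ->
  forall s t, tens_rel s t ->
  \sum_(p <- s) h p.1 p.2 = \sum_(p <- t) h p.1 p.2.
Proof.
move=> hl hr s t; elim=> {s t}.
- by [].
- by [].
- by move=> s t w _ -> _ ->.
- by move=> s s' t t' _ H _ K; rewrite !big_cat /= H K.
- by move=> s t; rewrite !big_cat /= addrC.
- move=> r; rewrite big_seq1 big_nil /=.
  by apply: (addrI (h 0 r)); rewrite -hl !addr0.
- by move=> u v r; rewrite !big_cons !big_nil /= !addr0 hl.
- by move=> v r s; rewrite !big_cons !big_nil /= !addr0 hr.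
Qed.

Lemma tens_prodE (f : V -> V -> V) u r v s :
  (forall x y z, f (x + y) z = f x z + f y z) ->
  (forall x y z, f z (x + y) = f z x + f z y) ->
  tens_prod f (tens u r) (tens v s) = tens (f u v) (r * s).
Proof.
move=> fl fr; rewrite /tens_prod.
rewrite (@sum_tens_rel _
  (fun x a => \sum_(q <- repr (tens v s)) tens (f x q.1) (a * q.2)) _ _ _ _
  (repr_class [:: (u, r)])).
- rewrite big_seq1 /= (@sum_tens_rel _ (fun y b => tens (f u y) (r * b)) _ _ _ _
    (repr_class [:: (v, s)])) ?big_seq1 //.
  + by move=> x y z; rewrite fr tensDl.
  + by move=> x y z; rewrite mulrDr tensDr.
- by move=> x y z; rewrite -big_split; apply: eq_bigr => q _; rewrite fl tensDl.
- by move=> x y z; rewrite -big_split; apply: eq_bigr => q _; rewrite mulrDl tensDr.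
Qed.

End BaseChange.

Record evenLattice := EvenLattice {
  lat :> zmodType;
  form : lat -> lat -> int;
  formDl : forall a b x, form (a + b) x = form a x + form b x;
  formC : forall a b, form a b = form b a;
  form_even : forall a, (2 %| form a a)%Z;
  form_nondegenerate : forall a, (forall b, form a b = 0) -> a = 0;
  lat_free : exists (n : nat) (b : 'I_n -> lat),
    forall a, exists! c : 'rV[int]_n, a = \sum_i b i *~ c 0 i }.

Record lattice_basis (L : evenLattice) (n : nat) := LatticeBasis {
  bas :> 'I_n -> L;
  coord : L -> 'rV[int]_n;
  coordK : forall a, \sum_i bas i *~ coord a 0 i = a;
  basK : forall c : 'rV[int]_n, coord (\sum_i bas i *~ c 0 i) = c }.

Definition gram (L : evenLattice) (n : nat) (alpha : lattice_basis L n) :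
  'M[int]_n := \matrix_(i, j) form (alpha i) (alpha j).

Definition positive_definite (L : evenLattice) : Prop :=
  forall a : L, a <> 0 -> (0 < form a a)%R.

Record central_extension (L : evenLattice) := CentralExtension {
  ext :> groupType;
  kappa : ext;
  proj : ext -> L;
  sect : L -> ext;
  projM : forall x y, proj (x * y)%g = proj x + proj y;
  kappa_neq1 : kappa <> 1%g;
  proj_ker : forall x, proj x = 0 <-> x = 1%g \/ x = kappa;
  kappa_central : forall x, (kappa * x = x * kappa)%g;
  ext_commutator : forall x y,
    (x * y = kappa ^+ `|form (proj x) (proj y)|%N * (y * x))%g;
  sectK : forall a, proj (sect a) = a;
  sect0 : sect 0 = 1%g }.

(* Basis element (a, mu) of VLQ is iota(e_a) times the product over (i, m) in
   the multiset mu of the elements alpha_i t^(-(m+1)); the free rational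
   module on these is the twisted group algebra tensored with Sym. *)
Definition VLQ (L : evenLattice) (n : nat) : lmodType rat :=
  {malg rat[(lat L * {mset ('I_n * nat)})%type]}.

Section LatticeVertexAlgebra.

Context {L : evenLattice} {n : nat}.
Variables (alpha : lattice_basis L n) (E : central_extension L).

Local Notation K := (lat L * {mset ('I_n * nat)})%type.
Local Notation V := (VLQ L n).

(* The linear endomorphism with prescribed values on the basis. *)
Definition lin_ext (f : K -> V) (v : V) : V :=
  \sum_(k <- msupp v) v@_k *: f k.

Definition iota_e (a : L) : V := << (a, mset0) >>.

Definition vacQ : V := iota_e 0.

(* In the twisted group ring kappa = -1, so that
   iota(e_a) iota(e_b) = cocycle a b * iota(e_(a+b)). *)
Definition cocycle (a b : L) : rat :=
  if (sect E a * sect E b)%g == sect E (a + b) then 1 else -1.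

Definition e_act (a : L) : V -> V :=
  lin_ext (fun k => cocycle a k.1 *: << (a + k.1, k.2) >>).

(* Elements of L \otimes rat are given by their coordinates in alpha. *)
Definition formQ (b : 'rV[rat]_n) (a : L) : rat :=
  \sum_i b 0 i * (form (alpha i) a)%:~R.

Definition toQ (a : L) : 'rV[rat]_n := map_mx intr (coord alpha a).

(* The operator b(k).  Negz m is -(m+1). *)
Definition heis (b : 'rV[rat]_n) (k : int) : V -> V :=
  match k with
  | Negz m =>
      lin_ext (fun x => \sum_i b 0 i *: << (x.1, (i, m) +` x.2) >>)
  | Posz 0 => lin_ext (fun x => formQ b x.1 *: << x >>)
  | Posz m.+1 =>
      lin_ext (fun x => \sum_i
        (m.+1%:R * formQ b (alpha i) * (x.2 (i, m))%:R)
          *: << (x.1, x.2 `\ (i, m)) >>)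
  end.

(* Coefficient of z^N in (\sum_(m > 0) f_m z^m)^k, applied to v. *)
Fixpoint series_pow (f : nat -> V -> V) (k N : nat) (v : V) : V :=
  if k is k'.+1 then
    \sum_(j < N) f j.+1 (series_pow f k' (N - j.+1) v)
  else if N == 0%N then v else 0.

(* Coefficient of z^N in exp(\sum_(m > 0) f_m z^m), applied to v. *)
Definition series_exp (f : nat -> V -> V) (N : nat) (v : V) : V :=
  \sum_(k < N.+1) (k`!%:R : rat)^-1 *: series_pow f k N v.

Definition exp_creation (a : L) : nat -> V -> V :=
  series_exp (fun m v => (m%:R : rat)^-1 *: heis (toQ a) (- m%:Z) v).

Definition exp_annihilation (a : L) : nat -> V -> V :=
  series_exp (fun m v => - ((m%:R : rat)^-1 *: heis (toQ a) m%:Z v)).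

(* [is_lattice_va Y] characterizes Y as the vertex algebra structure on VLQ.
   In [lva_exp], v is homogeneous of lattice degree b and the coefficient of
   z^(-k-1) of Y(iota(e_a), z) v is the sum over q of the terms
   z^p z^(-q) z^(a, b) with p - q + (a, b) = - k - 1; the annihilation part
   kills v for q large. *)
Record is_lattice_va (Y : int -> V -> V -> V) : Prop := {
  lva_va : vertex_algebra vacQ Y;
  lva_heis : forall (b : 'rV[rat]_n) (k : int) v,
    Y k (heis b (-1) vacQ) v = heis b k v;
  lva_exp : forall (a b : L) v (k : int),
    (forall x, x \in msupp v -> x.1 = b) ->
    exists N0 : nat, forall N : nat, (N0 <= N)%N ->
      Y k (iota_e a) v =
      \sum_(q < N)
        match q%:Z - k - 1 - form a b with
        | Posz p => exp_creation a p (exp_annihilation a q (e_act a v))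
        | Negz _ => 0
        end }.

Definition mset_weight (mu : {mset ('I_n * nat)}) : nat :=
  \sum_(x <- finsupp mu) mu x * x.2.+1.

Definition degQ (d : int) (v : V) : Prop :=
  forall x, x \in msupp v ->
    (mset_weight x.2)%:Z + (form x.1 x.1 %/ 2)%Z = d.

(* Multiplication by s_(a, N). *)
Definition s_op (a : L) (N : nat) : V -> V :=
  series_exp (fun m v => - ((m%:R : rat)^-1 *: heis (toQ a) (- m%:Z) v)) N.

Definition VL_gen (s : seq (L * nat)) (a : L) : V :=
  foldr (fun p w => s_op p.1 p.2 w) (iota_e a) s.

Definition in_VL (v : V) : Prop :=
  exists s : seq (int * (seq (L * nat) * L)),
    v = \sum_(x <- s) VL_gen x.2.1 x.2.2 *~ x.1.

Definition VL_pred : {pred V} := fun v => `[< in_VL v >].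

Lemma VL_pred_zmod : zmod_closed VL_pred.
Proof.
split; first by apply/asboolP; exists [::]; rewrite big_nil.
move=> _ _ /asboolP[s ->] /asboolP[t ->]; apply/asboolP.
exists (s ++ [seq (- x.1, x.2) | x <- t]); rewrite big_cat big_map /=.
by congr (_ + _); rewrite -sumrN; apply: eq_bigr => x _; rewrite mulrNz.
Qed.

HB.instance Definition _ := GRing.isZmodClosed.Build V VL_pred VL_pred_zmod.

Record VL := MkVL { VL_val :> V; VL_valP : VL_val \in VL_pred }.

HB.instance Definition _ := [isSub for VL_val].
HB.instance Definition _ := [Choice of VL by <:].
HB.instance Definition _ := [SubChoice_isSubZmodule of VL by <:].

Lemma vacQ_in_VL : vacQ \in VL_pred.
Proof.
by apply/asboolP; exists [:: (1, ([::], 0))]; rewrite big_seq1 /= mulr1z.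
Qed.

Definition vacZ : VL := MkVL vacQ_in_VL.

Lemma lin_extN f v : lin_ext f (- v) = - lin_ext f v.
Proof.
rewrite /lin_ext msuppN -sumrN; apply: eq_bigr => k _.
by rewrite mcoeffN scaleNr.
Qed.

Lemma heisN b k v : heis b k (- v) = - heis b k v.
Proof. by case: k => [[|m]|m]; rewrite /heis lin_extN. Qed.

Lemma s_op1 a v : s_op a 1 v = - heis (toQ a) (-1) v.
Proof.
rewrite /s_op /series_exp !big_ord_recl big_ord0 addr0 /= scaler0 add0r.
by rewrite big_ord_recl big_ord0 addr0 /= invr1 !scale1r.
Qed.

(* alpha_i(-1) alpha_j(-1) 1 *)
Definition heis2Q (i j : 'I_n) : V :=
  heis (toQ (alpha i)) (-1) (heis (toQ (alpha j)) (-1) vacQ).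

Lemma heis2Q_in_VL i j : heis2Q i j \in VL_pred.
Proof.
apply/asboolP; exists [:: (1, ([:: (alpha i, 1%N); (alpha j, 1%N)], 0))].
by rewrite big_seq1 mulr1z /VL_gen [foldr _ _ _]/= !s_op1 heisN opprK.
Qed.

Definition heis2 (i j : 'I_n) : VL := MkVL (heis2Q_in_VL i j).

(* Products of VLQ preserve VL; the default value 0 of insubd is not used
   when Y is the vertex algebra structure on VLQ. *)
Definition prodZ (Y : int -> V -> V -> V) (k : int) (u v : VL) : VL :=
  insubd (0 : VL) (Y k (VL_val u) (VL_val v)).

Variable R : comPzRingType.

Definition VLR : lmodType R := tensor R VL.

Definition vacR : VLR := tens vacZ 1.

Definition prodR (Y : int -> V -> V -> V) (k : int) : VLR -> VLR -> VLR :=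
  tens_prod (prodZ Y k).

Definition degR (d : int) (w : VLR) : Prop :=
  exists s : seq (VL * R),
    (forall p, p \in s -> degQ d (VL_val p.1)) /\
    w = \sum_(p <- s) tens p.1 p.2.

Definition omegaR (C : 'M[R]_n) : VLR :=
  \sum_i C i i *: tens (heis2 i i) 1
  + \sum_(i < n) \sum_(j < n | (i < j)%N) C i j *: tens (heis2 i j) 1.

End LatticeVertexAlgebra.

Arguments vacR {L n} alpha R.
Arguments prodR {L n} alpha R Y.
Arguments degR {L n} alpha R.
Arguments omegaR {L n} alpha {R}.

(* When u is the inverse of d in R: x lies in Z[1/d], and r is its image under
   the ring homomorphism from Z[1/d] to R; such an r is unique. *)
Definition loc_image (R : comPzRingType) (d : int) (u : R) (x : rat) (r : R) :
  Prop :=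
  exists (p : int) (k : nat),
    x * d%:~R ^+ k = p%:~R /\ r = p%:~R * u ^+ k.

Definition gram_inv (L : evenLattice) (n : nat) (alpha : lattice_basis L n) :
  'M[rat]_n := invmx (map_mx intr (gram alpha)).

(* Main.v *)
(* Over the rationals everything follows from the Borcherds identity.  The
   Heisenberg relations give the commutators of the coefficients of the
   exponentials, whose structure constants are the coefficients of
   (1 - x)^(-(a, b)), hence integers; so every product u_k preserves V_L as soon
   as u = iota(e_a), and the set of all such u is closed under products and
   contains each generator of V_L (induction on the weight, starting from a
   product with e_(-b)).  With omega written in dual bases, b_(1) omega = b and
   b_(i) omega = 0 for i <> 1, so [b(m), L_k] = m b(m + k), which determines L_0,
   L_(-1) and the Virasoro relations.

   Since adj(G) G adj(G) = det(G) adj(G) and the lattice is even,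
   det(G) adj(G)_(i,i) is even, so det(G)^2 omega lies in V_L, and all the
   identities pass from V_L to V_L \otimes R, where det(G) is invertible.

   In the positive definite case a degree has finitely many monomials, and N! s_(a,N)
   has integral coefficients; thus a degree piece of V_L is a subgroup of a
   lattice, hence free of finite rank, and so is its base change. *)
From HB Require Import structures.
From mathcomp Require Import all_boot all_order all_algebra.
From mathcomp Require Import finmap multiset monalg boolp ring zify.
Require Import Defs.

Set Implicit Arguments.
Unset Strict Implicit.
Unset Printing Implicit Defensive.

Import Order.TTheory GRing.Theory Num.Theory.
Local Open Scope ring_scope.
Local Open Scope mset_scope.

(** * Linear extensions and exponential series *)

Section LinExt.
Context {L : evenLattice} {n : nat}.
Local Notation K := (lat L * {mset ('I_n * nat)})%type.
Local Notation V := (VLQ L n).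

(** Exponentials enter only through the recursion that comes from z E' = z g' E: it expresses N
    times the N-th coefficient by lower ones. The rules for moving an exponential past other
    operators are proved from it by strong induction on N, cancelling N over the rationals. The
    obstacle is that integers may be zero divisors in R, and 2 in particular need not be invertible,
    so nothing can be divided after base change. Each identity is therefore proved in [VLQ],
    rewritten in V_L with its denominators cleared, and only then tensored. With D = det G,
    relations linear in omega are multiplied by D^2, while the Virasoro relation, quadratic in
    omega, is multiplied by D^4; the factors u^2 and u^4 undo this in R. *)

Lemma lin_extEw (f : K -> V) (d : {fset K}) (v : V) :
  (msupp v `<=` d)%fset -> lin_ext f v = \sum_(k <- d) v@_k *: f k.
Proof.
move=> le; rewrite /lin_ext (big_fset_incl _ le) // => k _ /mcoeff_outdom ->.
by rewrite scale0r.
Qed.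

Lemma lin_ext_linear (f : K -> V) : linear (lin_ext f).
Proof.
move=> c u v.
pose d := (msupp u `|` msupp v `|` msupp (c *: u + v))%fset.
rewrite !(@lin_extEw f d); try by apply/fsubsetP=> x xi; rewrite !inE xi ?orbT.
rewrite scaler_sumr -big_split; apply: eq_bigr => k _ /=.
by rewrite mcoeffD mcoeffZ scalerDl scalerA.
Qed.

HB.instance Definition _ f :=
  GRing.isLinear.Build rat V V *:%R (lin_ext f) (lin_ext_linear f).

Lemma lin_extU (f : K -> V) k : lin_ext f << k >> = f k.
Proof.
by rewrite (@lin_extEw f [fset k]%fset) ?msuppU_le // big_seq_fset1 mcoeffUU scale1r.
Qed.

Lemma malg_sum (v : V) : v = \sum_(k <- msupp v) v@_k *: << k >>.
Proof.
rewrite {1}[v]monalgE; apply: eq_bigr => k _; apply/malgP => x.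
by rewrite mcoeffZ !mcoeffU -mulr_natr -mulr_natr mul1r.
Qed.

Lemma eq_linear_basis (f g : {linear V -> V}) :
  (forall k, f << k >> = g << k >>) -> f =1 g.
Proof.
move=> fg v; rewrite [v]malg_sum !linear_sum; apply: eq_bigr => k _.
by rewrite !linearZ fg.
Qed.
End LinExt.

(** Both sides run over the pairs with (i + 1) + (j + 1) <= N, the exponents of two factors without
    constant term. *)
Lemma sum_triangle (V : zmodType) (N : nat) (F : nat -> nat -> V) :
  \sum_(i < N) \sum_(j < N - i.+1) F i j = \sum_(j < N) \sum_(i < N - j.+1) F i j.
Proof.
have E (G : nat -> nat -> V) : \sum_(i < N) \sum_(j < N - i.+1) G i j
    = \sum_(i < N) \sum_(j < N | (i + j < N.-1)%N) G i j.
  apply: eq_bigr => i _; rewrite (big_ord_widen_cond N predT (G i)) ?leq_subr //.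
  by apply: eq_bigl => j /=; have := ltn_ord i; lia.
rewrite (E F) (E (fun j i => F i j)) (exchange_big_dep xpredT) //=; apply: eq_bigr => j _.
by apply: eq_bigl => i; rewrite addnC.
Qed.

Section SeriesExp.
Context {L : evenLattice} {n : nat}.
Local Notation V := (VLQ L n).
Variable f : nat -> V -> V.
Hypothesis flin : forall m, linear (f m).
HB.instance Definition _ m :=
  GRing.isLinear.Build rat V V *:%R (f m) (flin m).

Lemma series_pow_linear k N : linear (series_pow f k N).
Proof.
elim: k N => [|k IH] N c u v /=; first by case: ifP; rewrite ?scaler0 ?addr0.
rewrite scaler_sumr -big_split; apply: eq_bigr => j _ /=.
by rewrite IH linearP.
Qed.

HB.instance Definition _ k N :=
  GRing.isLinear.Build rat V V *:%R (series_pow f k N) (series_pow_linear k N).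

Lemma series_exp_linear N : linear (series_exp f N).
Proof.
move=> c u v; rewrite /series_exp scaler_sumr -big_split; apply: eq_bigr => k _ /=.
by rewrite linearP scalerDr !scalerA [_ * c]mulrC.
Qed.

Lemma series_exp0 v : series_exp f 0 v = v.
Proof. by rewrite /series_exp big_ord1 invr1 scale1r. Qed.

(** A series without constant term has a k-th power starting at z^k. Hence the sum in [series_exp]
    stops at N without losing a term, and any larger bound may replace N. *)
Lemma series_pow_gt k N v : (N < k)%N -> series_pow f k N v = 0.
Proof.
elim: k N => // k IH N ltNk /=; rewrite big1 // => j _.
by rewrite IH ?linear0 //; have := ltn_ord j; lia.
Qed.

Lemma series_expE M N v : (N <= M)%N ->
  series_exp f N v = \sum_(k < M.+1) (k`!%:R : rat)^-1 *: series_pow f k N v.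
Proof.
move=> leNM; rewrite /series_exp (big_ord_widen M.+1
  (fun k => (k`!%:R : rat)^-1 *: series_pow f k N v)) //.
rewrite big_mkcond; apply: eq_bigr => k _; case: ifP => // /negbT.
by rewrite -leqNgt => ltNk; rewrite series_pow_gt ?scaler0.
Qed.

Hypothesis fC : forall i j v, f i.+1 (f j.+1 v) = f j.+1 (f i.+1 v).

(* The derivative of the k-th power of the generating series. *)
Lemma series_pow_rec k N v :
  N%:R *: series_pow f k.+1 N v =
  k.+1%:R *: \sum_(j < N) j.+1%:R *: f j.+1 (series_pow f k (N - j.+1) v).
Proof.
elim: k N => [|k IH] N.
  rewrite scale1r /= scaler_sumr; apply: eq_bigr => j _.
  case: ifP => [|_]; last by rewrite linear0 !scaler0.
  by have := ltn_ord j => ? ?; congr (_%:R *: _); lia.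
rewrite [series_pow _ k.+2 _ _]/=.
(* Leibniz rule: N = (j + 1) + (N - j - 1) splits the derivative between the outer factor and the
   remaining power. *)
have -> : N%:R *: \sum_(j < N) f j.+1 (series_pow f k.+1 (N - j.+1) v)
  = \sum_(j < N) j.+1%:R *: f j.+1 (series_pow f k.+1 (N - j.+1) v)
  + \sum_(j < N) f j.+1 ((N - j.+1)%:R *: series_pow f k.+1 (N - j.+1) v).
  rewrite scaler_sumr -big_split; apply: eq_bigr => j _ /=.
  rewrite linearZ -scalerDl -natrD; congr (_%:R *: _).
  by have := ltn_ord j; lia.
rewrite -[k.+2]addn1 natrD scalerDl scale1r addrC; congr (_ + _).
under eq_bigr => j _ do rewrite IH linearZ /= linear_sum.
rewrite -scaler_sumr; congr (_ *: _).
(* The differentiated factor sits inside; exchanging the indices and commuting the two operators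
   brings it to the front. *)
rewrite (sum_triangle N (fun j i => f j.+1
  (i.+1%:R *: f i.+1 (series_pow f k (N - j.+1 - i.+1) v)))).
apply: eq_bigr => i _; rewrite linear_sum scaler_sumr; apply: eq_bigr => j _.
by rewrite linearZ /= fC subnAC.
Qed.

(* Comparing coefficients in [z E' = z g' E] for [E = exp g]. *)
Lemma series_exp_rec N v :
  N%:R *: series_exp f N v =
  \sum_(j < N) j.+1%:R *: f j.+1 (series_exp f (N - j.+1) v).
Proof.
case: N => [|N]; first by rewrite scale0r big_ord0.
rewrite {1}/series_exp big_ord_recl /= scaler0 add0r scaler_sumr.
under [RHS]eq_bigr => j _ do
  rewrite (@series_expE N) ?subSS ?leq_subr ?linear_sum ?scaler_sumr //.
rewrite exchange_big; apply: eq_bigr => k _ /=.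
rewrite scalerA mulrC -scalerA series_pow_rec scalerA.
have -> : ((k.+1)`!%:R : rat)^-1 * k.+1%:R = (k`!%:R)^-1.
  by rewrite factS natrM invfM mulrAC mulVf ?pnatr_eq0 // mul1r.
rewrite scaler_sumr; apply: eq_bigr => j _.
by rewrite [f _ (_ *: _)]linearZ /= !scalerA mulrC subSS.
Qed.
End SeriesExp.

(** * Vertex algebras *)

Lemma binz0r r : binz r 0 = 1.
Proof. by rewrite /binz big_ord0 divz1. Qed.

Lemma binz1r r : binz r 1 = r.
Proof. by rewrite /binz big_ord1 subr0 divz1. Qed.

Lemma signz0 : signz 0 = 1. Proof. by []. Qed.

Lemma binz0l i : binz 0 i = (i == 0%N)%:R.
Proof.
by case: i => [|i]; rewrite ?binz0r // /binz big_ord_recl subrr mul0r div0z.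
Qed.

Lemma binzN1 i : binz (-1) i = (-1) ^+ i.
Proof.
rewrite /binz (_ : \prod_(j < i) _ = (-1) ^+ i * (i`!)%:Z).
  by rewrite mulzK // eqz_nat -lt0n fact_gt0.
elim: i => [|i IH]; first by rewrite big_ord0.
rewrite big_ord_recr /= IH factS exprS.
rewrite PoszM -[i.+1]addn1 PoszD; ring.
Qed.

Section VertexAlgebraTheory.
Context {R : comPzRingType} {V : lmodType R}.
Variables (vac : V) (Y : int -> V -> V -> V).
Hypothesis va : vertex_algebra vac Y.

Lemma Y_linr k u : linear (Y k u).
Proof. exact: va_linr va k u. Qed.

Let Yl k v u := Y k u v.

Lemma Y_linl k v : linear (Yl k v).
Proof. rewrite /Yl. by move=> a u u'; rewrite (va_linl va). Qed.

HB.instance Definition _ k u :=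
  GRing.isLinear.Build R V V *:%R (Y k u) (Y_linr k u).
HB.instance Definition _ k v :=
  GRing.isLinear.Build R V V *:%R (Yl k v) (Y_linl k v).

Lemma Y0r k u : Y k u 0 = 0. Proof. exact: linear0. Qed.
Lemma Y0l k v : Y k 0 v = 0. Proof. exact: (linear0 (Yl k v)). Qed.
Lemma YDr k u v w : Y k u (v + w) = Y k u v + Y k u w.
Proof. exact: linearD. Qed.
Lemma YDl k u v w : Y k (u + v) w = Y k u w + Y k v w.
Proof. exact: (linearD (Yl k w)). Qed.
Lemma YBr k u v w : Y k u (v - w) = Y k u v - Y k u w.
Proof. exact: linearB. Qed.
Lemma YBl k u v w : Y k (u - v) w = Y k u w - Y k v w.
Proof. exact: (linearB (Yl k w)). Qed.
Lemma YZr k a u v : Y k u (a *: v) = a *: Y k u v.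
Proof. exact: linearZ. Qed.
Lemma YZl k a u v : Y k (a *: u) v = a *: Y k u v.
Proof. exact: (linearZZ (Yl k v)). Qed.
Lemma Y_sumr k u I (r : seq I) P F :
  Y k u (\sum_(i <- r | P i) F i) = \sum_(i <- r | P i) Y k u (F i).
Proof. exact: linear_sum. Qed.
Lemma Y_suml k v I (r : seq I) P F :
  Y k (\sum_(i <- r | P i) F i) v = \sum_(i <- r | P i) Y k (F i) v.
Proof. exact: (linear_sum (Yl k v)). Qed.

(** The Borcherds identity at t = 0, where binom(0, i) leaves only the term i = 0 on the right. *)
Lemma va_commutator m k u v w : exists N0 : nat, forall N : nat, (N0 <= N)%N ->
  Y m u (Y k v w) - Y k v (Y m u w)
  = \sum_(i < N) Y (m + k - i%:Z) (Y i%:Z u v) w *~ binz m i.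
Proof.
have [N0 H] := va_borcherds va m k 0 u v w.
(* The bound must be positive for the surviving term i = 0 to be in the sum. *)
exists N0.+1 => -[//|N] leN.
have /esym := H N.+1 (ltnW leN).
under [X in _ = X -> _]eq_bigr => i _ do rewrite add0r.
move=> <-; rewrite big_ord_recl big1 => [|i _].
  by rewrite binz0l /= !(subr0, addr0) mulr1 signz0 !mulr1z.
by rewrite binz0l mulr0 mulr0z.
Qed.

Lemma va_commutator_trunc M m k u v w :
  (forall i, (M <= i)%N -> Y i%:Z u v = 0) ->
  Y m u (Y k v w) - Y k v (Y m u w)
  = \sum_(i < M) Y (m + k - i%:Z) (Y i%:Z u v) w *~ binz m i.
Proof.
move=> HM; have [N0 H] := va_commutator m k u v w.
rewrite (H (maxn N0 M)) ?leq_maxl //.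
rewrite [RHS](big_ord_widen (maxn N0 M)
  (fun i : nat => Y (m + k - i%:Z) (Y i%:Z u v) w *~ binz m i)) ?leq_maxr //.
rewrite [RHS]big_mkcond; apply: eq_bigr => i _; case: ifP => // /negbT.
by rewrite -leqNgt => /HM ->; rewrite Y0l mul0rz.
Qed.

(** The Borcherds identity at r = 0. It expresses products by u_t v through products by u and by v,
    so stability under the latter passes to the former. *)
Lemma va_iterate t s u v w : exists N0 : nat, forall N : nat, (N0 <= N)%N ->
  Y s (Y t u v) w
  = \sum_(i < N) (Y (t - i%:Z) u (Y (s + i%:Z) v w)
       - Y (s + t - i%:Z) v (Y i%:Z u w) *~ signz t) *~ ((-1) ^+ i * binz t i).
Proof.
have [N0 H] := va_borcherds va 0 s t u v w.
exists N0.+1 => -[//|N] leN.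
have := H N.+1 (ltnW leN).
under [X in _ = X -> _]eq_bigr => i _ do rewrite !add0r.
move=> <-; rewrite big_ord_recl big1 => [|i _].
  by rewrite binz0r /= !(add0r, subr0, addr0) mulr1z.
by rewrite binz0l mulr0z.
Qed.

(** At t = -1 every (-1)^i binom(t, i) is 1 and (-1)^t is -1, which gives the normally ordered
    product. *)
Lemma va_normal_order s u v w : exists N0 : nat, forall N : nat, (N0 <= N)%N ->
  Y s (Y (-1) u v) w
  = \sum_(i < N) (Y (-1 - i%:Z) u (Y (s + i%:Z) v w)
       + Y (s - 1 - i%:Z) v (Y i%:Z u w)).
Proof.
have [N0 H] := va_iterate (-1) s u v w.
exists N0 => N leN; rewrite (H _ leN); apply: eq_bigr => i _.
by rewrite binzN1 -expr2 sqrr_sign mulr1z mulrN1z opprK.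
Qed.

Lemma va_normal_order2 s u v w :
  (forall i : nat, Y i.+1%:Z u w = 0) ->
  (forall i : nat, Y (s + i.+1%:Z) v w = 0) ->
  Y s (Y (-1) u v) w = Y (-1) u (Y s v w) + Y (s - 1) v (Y 0 u w).
Proof.
move=> u0 v0; have [N H] := va_normal_order s u v w.
rewrite (H N.+1) // big_ord_recl big1 => [|i _]; first by rewrite /= !(subr0, addr0).
by rewrite [lift _ _ : nat]lift0 u0 v0 !Y0r addr0.
Qed.

(** With T v = v_(-2) 1 this reads T (u_k v) = u_k (T v) - k u_(k-1) v. Nonnegative products kill
    the vacuum, so the iterate formula keeps only i = 0 and i = 1. *)
Lemma translationP k u v :
  Y (-2) (Y k u v) vac = Y k u (Y (-2) v vac) - Y (k - 1) u v *~ k.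
Proof.
have [N0 H] := va_iterate k (-2) u v vac.
rewrite (H (N0.+2)) ?leqW // !big_ord_recl big1 => [|i _].
  rewrite !binz0r binz1r /= !(va_create va) !Y0r !mul0rz !subr0 addr0.
  rewrite /bump /= (_ : -2 + 1%:Z = -1 :> int) // (va_create0 va).
  by rewrite mulr1 mulr1z expr1 mulN1r mulrNz.
have -> : -2 + (lift ord0 (lift ord0 i))%:Z = i by rewrite /= /bump /=; lia.
by rewrite !(va_create va) !Y0r mul0rz subr0 mul0rz.
Qed.

End VertexAlgebraTheory.

(** * Heisenberg operators *)

Section EvenLattice.
Variable L : evenLattice.
Implicit Types a b x : L.

Lemma formDr a b x : form x (a + b) = form x a + form x b.
Proof. by rewrite formC formDl !(formC _ x). Qed.

Lemma form0l x : form 0 x = 0.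
Proof. by apply: (addrI (form 0 x)); rewrite -formDl !addr0. Qed.

Lemma form0r x : form x 0 = 0.
Proof. by rewrite formC form0l. Qed.

Lemma formNl a x : form (- a) x = - form a x.
Proof. by apply: (addrI (form a x)); rewrite -formDl !subrr form0l. Qed.

Lemma formNr a x : form x (- a) = - form x a.
Proof. by rewrite formC formNl formC. Qed.

Lemma formMzl a x z : form (a *~ z) x = form a x * z.
Proof.
have nat_case m : form (a *~ m%:Z) x = form a x * m%:Z.
  elim: m => [|m IH]; first by rewrite mulr0z form0l mulr0.
  by rewrite -addn1 PoszD mulrzDr mulrDr formDl IH mulr1z mulr1.
by case: z => m //; rewrite NegzE mulrNz mulrN formNl nat_case.
Qed.

Lemma form_suml I (r : seq I) (F : I -> L) x :
  form (\sum_(i <- r) F i) x = \sum_(i <- r) form (F i) x.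
Proof. exact: (big_morph (fun a => form a x) (fun a b => formDl a b x) (form0l x)). Qed.
End EvenLattice.

Arguments heis : simpl never.
Arguments e_act : simpl never.

Section LatticeOperators.
Context {L : evenLattice} {n : nat}.
Variables (alpha : lattice_basis L n) (E : central_extension L).
Local Notation K := (lat L * {mset ('I_n * nat)})%type.
Local Notation V := (VLQ L n).
Local Notation formQ := (formQ alpha).
Local Notation toQ := (toQ alpha).
Local Notation heis := (heis alpha).
Local Notation iota_e := (@iota_e L n).
Local Notation vacQ := (@vacQ L n).
Implicit Types (a b : L) (v : V).

Lemma coordD a b : coord alpha (a + b) = coord alpha a + coord alpha b.
Proof.
rewrite -[RHS](basK alpha) -{1}(coordK alpha a) -{1}(coordK alpha b) -big_split.
by congr coord; apply: eq_bigr => i _; rewrite mxE mulrzDr.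
Qed.

Lemma coordN a : coord alpha (- a) = - coord alpha a.
Proof.
rewrite -[RHS](basK alpha) -{1}(coordK alpha a) -sumrN.
by congr coord; apply: eq_bigr => i _; rewrite mxE mulrNz.
Qed.

Lemma coord_bas i : coord alpha (alpha i) = delta_mx 0 i.
Proof.
rewrite -[RHS](basK alpha); congr coord; rewrite (bigD1 i) //= big1 => [|j ne].
  by rewrite mxE !eqxx addr0.
by rewrite mxE (negbTE ne) andbF mulr0z.
Qed.

Lemma toQN a : toQ (- a) = - toQ a.
Proof. by apply/matrixP => i j; rewrite /Defs.toQ coordN !mxE rmorphN. Qed.

Lemma toQ_bas i : toQ (alpha i) = delta_mx 0 i.
Proof. by rewrite /Defs.toQ coord_bas map_delta_mx. Qed.

Lemma formQ_linl t (b c : 'rV_n) a : formQ (t *: b + c) a = t * formQ b a + formQ c a.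
Proof.
rewrite /Defs.formQ mulr_sumr -big_split; apply: eq_bigr => i _ /=.
by rewrite !mxE mulrDl mulrA.
Qed.

Lemma formQ0 (b : 'rV_n) : formQ b 0 = 0.
Proof. by rewrite /Defs.formQ big1 // => i _; rewrite form0r mulr0. Qed.

Lemma formQ_toQ a b : formQ (toQ a) b = (form a b)%:~R.
Proof.
rewrite -{2}(coordK alpha a) form_suml rmorph_sum; apply: eq_bigr => i _ /=.
by rewrite mxE formMzl mulrC rmorphM.
Qed.

Definition bformQ (b c : 'rV[rat]_n) : rat := \sum_j c 0 j * formQ b (alpha j).

Lemma bformQ_toQ (b : 'rV_n) a : bformQ b (toQ a) = formQ b a.
Proof.
rewrite -{2}(coordK alpha a) /Defs.formQ.
under [RHS]eq_bigr => i _ do rewrite formC form_suml rmorph_sum mulr_sumr /=.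
rewrite exchange_big; apply: eq_bigr => j _ /=; rewrite mulr_sumr.
by apply: eq_bigr => i _; rewrite mxE formMzl rmorphM formC /=; ring.
Qed.

Lemma heis_linear (b : 'rV_n) k : linear (heis b k).
Proof. by case: k => [[|m]|m]; apply: lin_ext_linear. Qed.

HB.instance Definition _ (b : 'rV_n) k :=
  GRing.isLinear.Build rat V V *:%R (heis b k) (heis_linear b k).

HB.instance Definition _ a :=
  GRing.isLinear.Build rat V V *:%R (e_act E a)
    (lin_ext_linear (fun k => cocycle E a k.1 *: << (a + k.1, k.2) >>)).

Lemma heis_linl (b c : 'rV_n) t k v :
  heis (t *: b + c) k v = t *: heis b k v + heis c k v.
Proof.
case: k => [[|m]|m]; rewrite /Defs.heis /lin_ext scaler_sumr -big_split;
  apply: eq_bigr => x _ /=.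
- by rewrite formQ_linl !scalerDl !scalerDr !scalerA !mulrA [_ * t]mulrC.
- rewrite scalerA mulrC -scalerA -scalerDr; congr (_ *: _).
  rewrite scaler_sumr -big_split; apply: eq_bigr => i _ /=.
  by rewrite formQ_linl scalerA -scalerDl; congr (_ *: _); rewrite /GRing.scale /=; ring.
- rewrite scalerA mulrC -scalerA -scalerDr; congr (_ *: _).
  rewrite scaler_sumr -big_split; apply: eq_bigr => i _ /=.
  by rewrite !mxE scalerA -scalerDl.
Qed.

Lemma heisNl (b : 'rV_n) k v : heis (- b) k v = - heis b k v.
Proof.
have -> : - b = (-1) *: b + 0 by rewrite scaleN1r addr0.
rewrite heis_linl scaleN1r.
have -> : heis 0 k v = 0; last by rewrite !addr0.
apply: (addrI (heis 0 k v)).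
by rewrite -{1}[heis 0 k v]scale1r -heis_linl scaler0 !addr0.
Qed.

Lemma heis_suml I (r : seq I) (c : I -> rat) (F : I -> 'rV_n) k v :
  heis (\sum_(i <- r) c i *: F i) k v = \sum_(i <- r) c i *: heis (F i) k v.
Proof.
elim: r => [|i r IH]; last by rewrite !big_cons heis_linl IH.
by rewrite !big_nil -[0 in LHS](subrr 0) -scaleN1r addrC heis_linl scaleN1r addNr.
Qed.

Lemma heis0U (b : 'rV_n) (x : K) : heis b 0 << x >> = formQ b x.1 *: << x >>.
Proof. by rewrite [LHS]lin_extU. Qed.

Lemma heisPU (b : 'rV_n) m (x : K) : heis b m.+1%:Z << x >> =
  \sum_i (m.+1%:R * formQ b (alpha i) * (x.2 (i, m))%:R)
    *: << (x.1, x.2 `\ (i, m)) >>.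
Proof. by rewrite [LHS]lin_extU. Qed.

Lemma heisNU (b : 'rV_n) m (x : K) :
  heis b (Negz m) << x >> = \sum_i b 0 i *: << (x.1, (i, m) +` x.2) >>.
Proof. by rewrite [LHS]lin_extU. Qed.

Lemma heisN_deltaU i m (x : K) :
  heis (delta_mx 0 i) (Negz m) << x >> = << (x.1, (i, m) +` x.2) >>.
Proof.
rewrite heisNU (bigD1 i (erefl true)) big1 => [|j /andP[_ ne]].
  by rewrite mxE !eqxx scale1r /= addr0.
by rewrite mxE (negbTE ne) andbF scale0r.
Qed.

Lemma e_actU a (x : K) :
  e_act E a << x >> = cocycle E a x.1 *: << (a + x.1, x.2) >>.
Proof. by rewrite [LHS]lin_extU. Qed.

Lemma cocycle0 a : cocycle E a 0 = 1.
Proof. by rewrite /cocycle sect0 mulg1 addr0 eqxx. Qed.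

Lemma e_act_heis a (b : 'rV_n) m v :
  e_act E a (heis b (Negz m) v) = heis b (Negz m) (e_act E a v).
Proof.
apply: (eq_linear_basis (f := e_act E a \o heis b (Negz m))
  (g := heis b (Negz m) \o e_act E a)) => x /=.
rewrite heisNU e_actU linear_sum [heis _ _ (_ *: _)]linearZ /= heisNU scaler_sumr.
apply: eq_bigr => i _ /=; rewrite [e_act _ _ (_ *: _)]linearZ /= e_actU !scalerA.
by rewrite mulrC.
Qed.

Lemma heis_iota_pos (b : 'rV_n) m a : heis b m.+1%:Z (iota_e a) = 0.
Proof.
by rewrite heisPU big1 // => i _; rewrite /= mset0E mulr0 scale0r.
Qed.

Lemma heis_iota0 (b : 'rV_n) a : heis b 0 (iota_e a) = formQ b a *: iota_e a.
Proof. exact: heis0U. Qed.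

Lemma heis0_heisN (b c : 'rV_n) m : heis b 0 (heis c (Negz m) vacQ) = 0.
Proof.
rewrite (heisNU c m (0, mset0)) linear_sum big1 // => j _ /=.
by rewrite [heis _ _ (_ *: _)]linearZ /= heis0U formQ0 scale0r scaler0.
Qed.

Lemma heisP_heisN (b c : 'rV_n) k :
  heis b k.+1%:Z (heis c (-1) vacQ) = (if k == 0%N then bformQ b c else 0) *: vacQ.
Proof.
rewrite (heisNU c 0 (0, mset0)) linear_sum; case: eqP => [->|/eqP k0].
  rewrite /bformQ scaler_suml; apply: eq_bigr => j _ /=.
  rewrite [heis _ _ (_ *: _)]linearZ /= heisPU (bigD1 j) //= big1 => [|i ne].
    rewrite addr0 mset1DE mset0E eqxx addn0 mulr1 mul1r scalerA.
    by rewrite msetD1K.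
  by rewrite mset1DE mset0E xpair_eqE (negbTE ne) mulr0 scale0r.
rewrite scale0r big1 // => j _ /=; rewrite [heis _ _ (_ *: _)]linearZ /= heisPU big1 ?scaler0 // => i _.
by rewrite mset1DE mset0E xpair_eqE (negbTE k0) andbF mulr0 scale0r.
Qed.

Section HeisenbergCommutator.
Variable Y : int -> V -> V -> V.
Hypothesis hY : is_lattice_va alpha E Y.

(** Since b(m) is a product by b(-1) 1, the commutator formula reduces the relation to b(i) c(-1) 1,
    which is zero except for the multiple (b, c) of the vacuum at i = 1. *)
Lemma heis_commutator (b c : 'rV_n) (m k : int) v :
  heis b m (heis c k v) - heis c k (heis b m v)
  = (if m + k == 0 then m%:~R * bformQ b c else 0) *: v.
Proof.
have va := lva_va hY.
rewrite -!(lva_heis hY b m) -!(lva_heis hY c k).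
rewrite (@va_commutator_trunc _ _ _ _ va 2) => [|[|[|i]] // _].
  rewrite !big_ord_recl big_ord0 addr0 !(lva_heis hY) /=.
  rewrite heis0_heisN (Y0l va) mul0rz add0r (heisP_heisN _ _ 0) (YZl va).
  rewrite (va_vac va) binz1r -scaler_int scalerA subr_eq addNr.
  by case: ifP => _; rewrite addr0 ?scaler0 ?scale0r.
by rewrite (lva_heis hY) heisP_heisN scale0r.
Qed.

Lemma heisC (b c : 'rV_n) (m k : int) v : m + k != 0 ->
  heis b m (heis c k v) = heis c k (heis b m v).
Proof.
move=> /negbTE mk; apply/eqP; rewrite -subr_eq0 heis_commutator mk.
by rewrite scale0r.
Qed.
End HeisenbergCommutator.
End LatticeOperators.

(** * Exponentials of Heisenberg operators *)

Arguments s_op : simpl never.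
Arguments exp_creation : simpl never.
Arguments exp_annihilation : simpl never.

(* Coefficient of [x^i] in [(1 - x)^(- z)]. *)
Definition inv_binom (z : int) (i : nat) : int :=
  match z with
  | Posz m => 'C((m + i).-1, i)%:Z
  | Negz m => (-1) ^+ i * 'C(m.+1, i)%:Z
  end.

Lemma inv_binom0 z : inv_binom z 0 = 1.
Proof. by case: z => m; rewrite /inv_binom !bin0. Qed.

Lemma inv_binomS z i : inv_binom z i.+1 * i.+1%:Z = inv_binom z i * (z + i%:Z).
Proof.
case: z => m; rewrite /inv_binom.
  rewrite -PoszD -!PoszM addnS /=; congr Posz.
  case: (m + i)%N => [|k]; first by rewrite bin_small // mul0n muln0.
  by rewrite -pred_Sn mulnC -mul_bin_diag mulnC.
have H : i.+1%:Z * 'C(m.+1, i.+1)%:Z = (m.+1%:Z - i%:Z) * 'C(m.+1, i)%:Z.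
  case: (leqP i m.+1) => [le|lt].
    by rewrite subzn // -!PoszM mul_bin_left.
  by rewrite -PoszM mul_bin_left !bin_small // muln0; lia.
rewrite exprS NegzE; move: ((-1) ^+ i) H => s.
move: 'C(m.+1, i.+1)%:Z 'C(m.+1, i)%:Z => C' C H.
rewrite (_ : -1 * s * C' * _ = - s * (i.+1%:Z * C')); last by ring.
by rewrite H; ring.
Qed.

(** Logarithmic derivative: F = (1 - x)^(-z) satisfies x F' = z x F / (1 - x). *)
Lemma inv_binom_sum z i : i%:Z * inv_binom z i = z * \sum_(j < i) inv_binom z j.
Proof.
elim: i => [|i IH]; first by rewrite mul0r big_ord0 mulr0.
by rewrite big_ord_recr mulrDr -IH mulrC inv_binomS; ring.
Qed.

(** Pairs are grouped along l = i + j + 1. *)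
Lemma sum_diagonal (V : zmodType) (N : nat) (F : nat -> nat -> V) :
  \sum_(l < N) \sum_(i < l) F i (l - i.+1)%N
  = \sum_(i < N) \sum_(j < N - i.+1) F i j.
Proof.
elim: N => [|N IH]; first by rewrite !big_ord0.
rewrite big_ord_recr [RHS]big_ord_recr /= subnn big_ord0 addr0 IH -big_split.
apply: eq_bigr => i _ /=.
by rewrite [in RHS]subSS -(subnSK (ltn_ord i)) big_ord_recr.
Qed.

Lemma scale_nat_inj (V : lmodType rat) (N : nat) (x y : V) :
  N.+1%:R *: x = N.+1%:R *: y -> x = y.
Proof. by apply: scalerI; rewrite pnatr_eq0. Qed.

Lemma oppr_scale_comm (V : lmodType rat) (f g : {linear V -> V}) (c d : rat) :
  (forall v, f (g v) = g (f v)) ->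
  forall v, - (c *: f (- (d *: g v))) = - (d *: g (- (c *: f v))).
Proof.
move=> fg v; rewrite -!scaleNr [f _]linearZ_LR [g (_ *: f v)]linearZ_LR fg !scalerA.
by rewrite mulrC.
Qed.

(** * Subgroups generated by a set of vectors *)

Section ZSpan.
Variable V : zmodType.
Implicit Types (P Q : V -> Prop).

(** The generated subgroup is encoded impredicatively, so that a membership proof is its own
    induction principle. *)
Definition zspan P (v : V) : Prop := forall S : V -> Prop,
  S 0 -> (forall u w, S u -> S w -> S (u - w)) -> (forall u, P u -> S u) -> S v.

Lemma zspan0 P : zspan P 0. Proof. by []. Qed.

Lemma zspan_gen P v : P v -> zspan P v.
Proof. by move=> Pv S _ _; apply. Qed.

Lemma zspanB P u v : zspan P u -> zspan P v -> zspan P (u - v).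
Proof. by move=> Pu Pv S S0 SB SP; exact: SB (Pu S S0 SB SP) (Pv S S0 SB SP). Qed.

Lemma zspanN P v : zspan P v -> zspan P (- v).
Proof. by move=> Pv; rewrite -sub0r; apply: zspanB. Qed.

Lemma zspanD P u v : zspan P u -> zspan P v -> zspan P (u + v).
Proof. by move=> Pu Pv; rewrite -[v]opprK; exact: zspanB Pu (zspanN Pv). Qed.

Lemma zspan_sum P I (r : seq I) (C : pred I) (F : I -> V) :
  (forall i, C i -> zspan P (F i)) -> zspan P (\sum_(i <- r | C i) F i).
Proof.
by move=> PF; apply: big_ind => //; apply: zspanD.
Qed.

Lemma zspanMz P v z : zspan P v -> zspan P (v *~ z).
Proof.
move=> Pv; have H m : zspan P (v *+ m).
  by elim: m => // m IH; rewrite mulrS; apply: zspanD.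
by case: z => m; rewrite ?NegzE ?mulrNz; [|apply: zspanN]; apply: H.
Qed.

Lemma zspan_trans P Q v : (forall u, P u -> zspan Q u) -> zspan P v -> zspan Q v.
Proof. by move=> PQ Pv; apply: Pv PQ; [exact: zspan0 | exact: zspanB]. Qed.
End ZSpan.

Lemma zspan_additive (U V : zmodType) (f : {additive U -> V})
    (P : U -> Prop) (Q : V -> Prop) v :
  (forall u, P u -> zspan Q (f u)) -> zspan P v -> zspan Q (f v).
Proof.
move=> PQ Pv; apply: (Pv (fun u => zspan Q (f u))) PQ => [|u w Qu Qw].
  by rewrite raddf0.
by rewrite raddfB; apply: zspanB.
Qed.

Section Support.
Context {L : evenLattice} {n : nat}.
Local Notation K := (lat L * {mset ('I_n * nat)})%type.
Local Notation V := (VLQ L n).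
Implicit Types (P Q : K -> Prop) (v : V).

Definition supported P v : Prop := forall x, x \in msupp v -> P x.

Lemma supported0 P : supported P 0.
Proof. by move=> x; rewrite msupp0. Qed.

Lemma supportedU P x : P x -> supported P << x >>.
Proof. by move=> Px y; rewrite msuppU oner_eq0 inE => /eqP ->. Qed.

Lemma supportedZ P c v : supported P v -> supported P (c *: v).
Proof. by move=> Pv x /(fsubsetP (msuppZ_le c v)); apply: Pv. Qed.

Lemma supportedD P u v : supported P u -> supported P v -> supported P (u + v).
Proof.
move=> Pu Pv x /(fsubsetP (msuppD_le u v)); rewrite inE => /orP[]; [exact: Pu|exact: Pv].
Qed.

Lemma supportedN P v : supported P v -> supported P (- v).
Proof. by rewrite -scaleN1r; apply: supportedZ. Qed.

Lemma supported_sum P I (r : seq I) (C : pred I) (F : I -> V) :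
  (forall i, C i -> supported P (F i)) -> supported P (\sum_(i <- r | C i) F i).
Proof.
by move=> PF; apply: big_ind => //; [apply: supported0 | apply: supportedD].
Qed.

Lemma supported_lin_ext P Q f v :
  (forall x, P x -> supported Q (f x)) -> supported P v ->
  supported Q (lin_ext f v).
Proof.
move=> PQ Pv; rewrite /lin_ext big_seq; apply: supported_sum => x xv.
by apply: supportedZ; apply: PQ; apply: (Pv x).
Qed.

Lemma supported_heisN (alpha : lattice_basis L n) P Q (b : 'rV_n) m v :
  (forall x i, P x -> Q (x.1, (i, m) +` x.2)) -> supported P v ->
  supported Q (heis alpha b (Negz m) v).
Proof.
move=> PQ; apply: supported_lin_ext => x Px; apply: supported_sum => i _.
by apply: supportedZ; apply: supportedU; apply: PQ.
Qed.
End Support.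

(** * Recursions and commutation rules for the two halves of a vertex operator *)

Section Exponentials.
Context {L : evenLattice} {n : nat}.
Variables (alpha : lattice_basis L n) (E : central_extension L).
Local Notation V := (VLQ L n).
Local Notation formQ := (formQ alpha).
Local Notation toQ := (toQ alpha).
Local Notation heis := (heis alpha).
Local Notation s_op := (s_op alpha).
Local Notation exp_ann := (exp_annihilation alpha).
Local Notation iota_e := (@iota_e L n).
Implicit Types (a b : L) (v : V).

Variable Y : int -> V -> V -> V.
Hypothesis hY : is_lattice_va alpha E Y.

Let s_fun a (m : nat) v := - ((m%:R : rat)^-1 *: heis (toQ a) (- m%:Z) v).
Let ann_fun a (m : nat) v := - ((m%:R : rat)^-1 *: heis (toQ a) m%:Z v).

Let s_fun_linear a m : linear (s_fun a m).
Proof. by move=> c u v; rewrite /s_fun linearP scalerDr opprD !scalerN !scalerA mulrC. Qed.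

Let ann_fun_linear a m : linear (ann_fun a m).
Proof. by move=> c u v; rewrite /ann_fun linearP scalerDr opprD !scalerN !scalerA mulrC. Qed.

HB.instance Definition _ a N := GRing.isLinear.Build rat V V *:%R (s_op a N)
  (series_exp_linear (s_fun_linear a) N).
HB.instance Definition _ a N := GRing.isLinear.Build rat V V *:%R (exp_ann a N)
  (series_exp_linear (ann_fun_linear a) N).

Lemma s_op0 a v : s_op a 0 v = v.
Proof. exact: series_exp0. Qed.

Lemma exp_ann0 a v : exp_ann a 0 v = v.
Proof. exact: series_exp0. Qed.

(** The recursion for f_m = - a(-m) / m; its factor j + 1 cancels the denominator. *)
Lemma s_op_rec a N v : N%:R *: s_op a N v
  = - \sum_(j < N) heis (toQ a) (Negz j) (s_op a (N - j.+1) v).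
Proof.
have fC i j u : s_fun a i.+1 (s_fun a j.+1 u) = s_fun a j.+1 (s_fun a i.+1 u).
  by apply: oppr_scale_comm => {}u; apply: (heisC hY).

rewrite [LHS](series_exp_rec (s_fun_linear a) fC N v) -sumrN; apply: eq_bigr => j _.
by rewrite /s_fun scalerN scalerA divff ?scale1r // pnatr_eq0.
Qed.

Lemma exp_ann_rec a N v : N%:R *: exp_ann a N v
  = - \sum_(j < N) heis (toQ a) j.+1%:Z (exp_ann a (N - j.+1) v).
Proof.
have fC i j u : ann_fun a i.+1 (ann_fun a j.+1 u) = ann_fun a j.+1 (ann_fun a i.+1 u).
  by apply: oppr_scale_comm => {}u; apply: (heisC hY).

rewrite [LHS](series_exp_rec (ann_fun_linear a) fC N v) -sumrN; apply: eq_bigr => j _.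
by rewrite /ann_fun scalerN scalerA divff ?scale1r // pnatr_eq0.
Qed.

(** The creation half of a vertex operator thus consists of the operators that generate V_L. *)
Lemma exp_creationE a N v : exp_creation alpha a N v = s_op (- a) N v.
Proof.
rewrite /exp_creation /Defs.s_op; congr (series_exp _ N v).
by apply/funext => m; apply/funext => u; rewrite toQN heisNl scalerN opprK.
Qed.

Lemma exp_ann_iota a q b : exp_ann a q.+1 (iota_e b) = 0.
Proof.
elim/ltn_ind: q => q IH; apply: (@scale_nat_inj _ q).
rewrite exp_ann_rec scaler0 big1 ?oppr0 // => -[[|j] lt] _ /=.
  rewrite subSS subn0; case: q IH {lt} => [|q] IH; last by rewrite IH ?linear0.
  by rewrite exp_ann0 heis_iota_pos.
rewrite subSS; case E1: (q - j.+1)%N => [|k]; first by rewrite exp_ann0 heis_iota_pos.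
by rewrite IH ?linear0 //; lia.
Qed.

Lemma e_act_s_op c a N v : e_act E c (s_op a N v) = s_op a N (e_act E c v).
Proof.
elim/ltn_ind: N v => -[|N] IH v; first by rewrite !s_op0.
apply: (@scale_nat_inj _ N); rewrite s_op_rec -[LHS]linearZ /= s_op_rec.
rewrite [LHS]linearN; congr (- _); rewrite [LHS]linear_sum; apply: eq_bigr => j _ /=.
by rewrite e_act_heis IH // subSS ltnS leq_subr.
Qed.

(** Coefficientwise form of [b(m + 1), s_a(z)] = - (b, a) z^(m + 1) s_a(z). *)
Lemma heis_s_op (b : 'rV_n) m a N v : heis b m.+1%:Z (s_op a N v) =
  s_op a N (heis b m.+1%:Z v)
  - (if (m < N)%N then formQ b a *: s_op a (N - m.+1) v else 0).
Proof.
elim/ltn_ind: N v => -[|N] IH v; first by rewrite !s_op0 subr0.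
apply: (@scale_nat_inj _ N); rewrite scalerBr s_op_rec -[LHS]linearZ /= s_op_rec.
rewrite [LHS]linearN [X in - X = _]linear_sum /=.
(* Moving b(m + 1) past a(-j - 1) leaves a central term for j = m only; the induction hypothesis
   moves it past the rest. *)
have step (j : 'I_N.+1) : heis b m.+1 (heis (toQ a) (Negz j) (s_op a (N.+1 - j.+1) v))
  = heis (toQ a) (Negz j) (s_op a (N.+1 - j.+1) (heis b m.+1 v))
  - (if (m + j < N)%N then
      formQ b a *: heis (toQ a) (Negz j) (s_op a (N - m - j.+1) v) else 0)
  + (if j == m :> nat then (m.+1%:R * formQ b a) *: s_op a (N - m) v else 0).
  have /eqP := heis_commutator hY b (toQ a) m.+1%:Z (Negz j) (s_op a (N.+1 - j.+1) v).
  rewrite subr_eq => /eqP ->; rewrite [LHS]addrC IH ?subSS ?ltnS ?leq_subr //.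
  rewrite linearB /= bformQ_toQ; congr (_ - _ + _).
    rewrite ltn_subRL [(j + m)%N]addnC; case: ifP => [lt|_]; last exact: linear0.
    by rewrite [heis _ _ (_ *: _)]linearZ /=; congr (_ *: heis _ _ (s_op _ _ _)); lia.
  have -> : (m.+1%:Z + Negz j == 0) = (j == m :> nat) by lia.
  case: eqP => [->|_]; last by rewrite scale0r.
  by rewrite pmulrn.
rewrite [X in - X = _](eq_bigr _ (fun j _ => step j)).
rewrite big_split sumrB /= opprD opprB.
rewrite -addrA addrCA; congr (_ + _).
(* The recursion read backwards gives the weight N - m; the central term adds m + 1, for a total of
   N + 1. *)
have -> : \sum_(i < N.+1) (if (m + i < N)%N then
      formQ b a *: heis (toQ a) (Negz i) (s_op a (N - m - i.+1) v) else 0)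
    = - (formQ b a *: ((N - m)%:R *: s_op a (N - m) v)).
  rewrite s_op_rec scalerN opprK scaler_sumr -big_mkcond /=.
  rewrite (big_ord_widen N.+1 (fun i => formQ b a *: heis (toQ a) (Negz i)
    (s_op a (N - m - i.+1) v))); last by lia.
  by apply: eq_bigl => i /=; lia.
rewrite -big_mkcond /=; case: ltnP => [lt|ge].
  rewrite (big_pred1 (Ordinal lt)) => [|i /=]; last by rewrite -val_eqE.
  rewrite subSS -opprD !scalerA -scalerDl; congr (- (_ *: _)).
  by rewrite mulrC -mulrDl -natrD; congr (_%:R * _); lia.
rewrite big1 => [|i /eqP]; last by have := ltn_ord i; lia.
have -> : (N - m = 0)%N by lia.
by rewrite scale0r scaler0 !oppr0 add0r scaler0 oppr0.
Qed.
End Exponentials.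

(** * Products preserve the integral form *)

Section Closure.
Context {L : evenLattice} {n : nat}.
Variables (alpha : lattice_basis L n) (E : central_extension L).
Local Notation K := (lat L * {mset ('I_n * nat)})%type.
Local Notation V := (VLQ L n).
Local Notation formQ := (formQ alpha).
Local Notation toQ := (toQ alpha).
Local Notation heis := (heis alpha).
Local Notation s_op := (s_op alpha).
Local Notation exp_ann := (exp_annihilation alpha).
Local Notation VL_gen := (VL_gen alpha).
Local Notation iota_e := (@iota_e L n).
Implicit Types (a b : L) (v : V).

Variable Y : int -> V -> V -> V.
Hypothesis hY : is_lattice_va alpha E Y.

(* The coefficient of [w^N] in [w^i s_b(w)]. *)
Let s_shift b N i : V -> V := if (i <= N)%N then s_op b (N - i) else fun=> 0.

Let s_shift_linear b N i : linear (s_shift b N i).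
Proof.
rewrite /s_shift; case: ifP => _; first exact: linearP.
by move=> c u v; rewrite scaler0 addr0.
Qed.

HB.instance Definition _ b N i :=
  GRing.isLinear.Build rat V V *:%R (s_shift b N i) (s_shift_linear b N i).

(** The factor w^(m + 1) becomes a shift of i, and [s_shift] vanishing beyond N removes the case
    distinction. *)
Lemma heis_s_shift (c : 'rV_n) m b N i v : heis c m.+1%:Z (s_shift b N i v)
  = s_shift b N i (heis c m.+1%:Z v) - formQ c b *: s_shift b N (i + m.+1) v.
Proof.
rewrite /s_shift; case: (leqP i N) => [le|lt]; last first.
  by rewrite ifF ?scaler0 ?subr0; [exact: linear0 | lia].
rewrite (heis_s_op hY) (_ : (m < N - i)%N = (i + m.+1 <= N)%N); last by lia.
case: ifP => _; last by rewrite scaler0.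
by rewrite subnDA.
Qed.

(* Coefficientwise form of
   [A_a(z) s_b(w) = (1 - w / z)^(- (a, b)) s_b(w) A_a(z)]. *)
Lemma exp_ann_s_op a q b N v : exp_ann a q (s_op b N v)
  = \sum_(i < q.+1) (inv_binom (form a b) i)%:~R *: s_shift b N i (exp_ann a (q - i) v).
Proof.
elim/ltn_ind: q => -[|q] IH.
  by rewrite big_ord1 inv_binom0 scale1r !exp_ann0 /s_shift subn0.
apply: (@scale_nat_inj _ q); rewrite (exp_ann_rec hY).
pose c i : rat := (inv_binom (form a b) i)%:~R.
pose F i j := c i *: s_shift b N i (heis (toQ a) j.+1 (exp_ann a (q - i - j) v)).
pose G i j := ((form a b)%:~R * c i) *:
   s_shift b N (i + j.+1) (exp_ann a (q - i - j) v).
have step (j : 'I_q.+1) :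
   heis (toQ a) j.+1%:Z (exp_ann a (q.+1 - j.+1) (s_op b N v))
   = \sum_(i < q.+2 - j.+1) F i j - \sum_(i < q.+2 - j.+1) G i j.
  rewrite IH ?subSS ?ltnS ?leq_subr // linear_sum -sumrB subSn; last by rewrite -ltnS.
  apply: eq_bigr => i _ /=.
  rewrite [heis _ _ (_ *: _)]linearZ /= heis_s_shift scalerBr scalerA.
  by rewrite formQ_toQ [c i * _]mulrC (subnAC q j i).
rewrite [X in - X = _](eq_bigr _ (fun j _ => step j)) sumrB.
(* An empty last row puts the sum into the triangular shape. *)
have widen (H : nat -> nat -> V) :
    \sum_(j < q.+1) \sum_(i < q.+2 - j.+1) H i j
    = \sum_(j < q.+2) \sum_(i < q.+2 - j.+1) H i j.
  by rewrite [RHS]big_ord_recr /= subnn big_ord0 addr0.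
rewrite (widen F) (widen G) (sum_triangle q.+2 (fun j i => F i j)).
rewrite (sum_triangle q.+2 (fun j i => G i j)) -(sum_diagonal q.+2 G).
rewrite opprB -sumrB scaler_sumr; apply: eq_bigr => l _.
(* The recursion for the annihilation half, read backwards, contributes the weight q + 1 - l. *)
have -> : \sum_(j < q.+2 - l.+1) F l j
    = - (((q.+1 - l)%:R * c l) *: s_shift b N l (exp_ann a (q.+1 - l) v)).
  rewrite mulrC -scalerA -scalerN -[_%:R *: s_shift _ _ _ _]linearZ /= (exp_ann_rec hY).
  rewrite [s_shift _ _ _ (- _)]linearN /= opprK.
  have -> r (H : 'I_r -> V) : s_shift b N l (\sum_(j < r) H j)
    = \sum_(j < r) s_shift b N l (H j) by exact: linear_sum.
  rewrite scaler_sumr subSS.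
  by apply: eq_bigr => j _; rewrite /F; congr (_ *: s_shift _ _ _ (heis _ _ (exp_ann _ _ _))); lia.
(* Along i + j + 1 = l all terms carry the same vector, and [inv_binom_sum] gives the weight l. Both
   weights add up to q + 1, the factor to be cancelled. *)
have -> : \sum_(i < l) G i (l - i.+1)%N
    = (l%:R * c l) *: s_shift b N l (exp_ann a (q.+1 - l) v).
  rewrite /c [l%:R]pmulrn -rmorphM inv_binom_sum rmorphM rmorph_sum mulr_sumr scaler_suml.
  apply: eq_bigr => i _; rewrite /G; have lt := ltn_ord i.
  by congr (_ *: s_shift _ _ _ (exp_ann _ _ _)); lia.
rewrite opprK -scalerDl -mulrDl -natrD scalerA; congr ((_%:R * _) *: _).
by have := ltn_ord l; lia.
Qed.
Lemma VL_gen_cons p s a : VL_gen (p :: s) a = s_op p.1 p.2 (VL_gen s a).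
Proof. by []. Qed.

Lemma VL_gen_in s a : VL_gen s a \in VL_pred alpha.
Proof. by apply/asboolP; exists [:: (1, (s, a))]; rewrite big_seq1 mulr1z. Qed.

Lemma VL_zspan v : v \in VL_pred alpha ->
  zspan (fun u => exists s a, u = VL_gen s a) v.
Proof.
move/asboolP => [t ->]; apply: zspan_sum => x _; apply: zspanMz; apply: zspan_gen.
by exists x.2.1, x.2.2.
Qed.

Lemma zspan_VL P v : (forall u, P u -> u \in VL_pred alpha) -> zspan P v ->
  v \in VL_pred alpha.
Proof.
move=> PVL Pv; apply: (Pv (fun u => u \in VL_pred alpha)) => //.
  exact: rpred0.
by move=> u w; apply: rpredB.
Qed.

Lemma s_op_VL b N v : v \in VL_pred alpha -> s_op b N v \in VL_pred alpha.
Proof.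
move/VL_zspan => H; apply: (@zspan_VL (fun u => exists s a, u = VL_gen s a)).
  by move=> _ [s [a ->]]; apply: VL_gen_in.
by apply: (zspan_additive (f := s_op b N)) H => _ [s [a ->]]; apply: zspan_gen; exists ((b, N) :: s), a.
Qed.

Lemma cocycle_sign a b : cocycle E a b = 1 \/ cocycle E a b = -1.
Proof. by rewrite /cocycle; case: ifP; [left | right]. Qed.

Lemma e_act_gen c s a : e_act E c (VL_gen s a) = cocycle E c a *: VL_gen s (c + a).
Proof.
elim: s => [|p s IH]; first by rewrite [LHS]e_actU.
by rewrite !VL_gen_cons (e_act_s_op hY) IH [s_op _ _ (_ *: _)]linearZ.
Qed.

Definition gen_weight (s : seq (L * nat)) : nat := \sum_(p <- s) p.2.

(** Integral structure constants move the annihilation coefficients past every s operator, down to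
    the lattice vector that the positive ones kill. The size and the exact drop of weight are
    recorded for the induction in [preserves_VL_gen]. *)
Lemma exp_ann_gen a q s c : zspan
  (fun v => exists s', [/\ size s' = size s, (gen_weight s' + q = gen_weight s)%N
                        & v = VL_gen s' c])
  (exp_ann a q (VL_gen s c)).
Proof.
elim: s q => [|p s IH] q.
  case: q => [|q]; last by rewrite (exp_ann_iota hY); apply: zspan0.
  by rewrite exp_ann0; apply: zspan_gen; exists [::]; rewrite addn0.
rewrite VL_gen_cons exp_ann_s_op; apply: zspan_sum => i _.
rewrite scaler_int; apply: zspanMz; rewrite /s_shift.
case: leqP => [le|_]; last exact: zspan0.
apply: zspan_additive (IH _) => _ [s' [sz wt ->]].
apply: zspan_gen; exists ((p.1, p.2 - i)%N :: s'); split; rewrite //= ?sz //.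
rewrite /gen_weight !big_cons /= -!/(gen_weight _) -wt.
by have := ltn_ord i; lia.
Qed.

(** An arbitrary family D serves both for the lattice degree, where it is constant, and for the
    conformal degree. *)
Lemma supported_s_op (D : nat -> K -> Prop) a N m v :
  (forall j k x i, D k x -> D (k + j.+1)%N (x.1, (i, j) +` x.2)) ->
  supported (D m) v -> supported (D (m + N)%N) (s_op a N v).
Proof.
move=> DP Dv; elim/ltn_ind: N => -[|N] IH; first by rewrite addn0 s_op0.
rewrite -[s_op _ _ _]scale1r -(@mulVf _ N.+1%:R) ?pnatr_eq0 // -scalerA (s_op_rec hY).
apply: supportedZ; apply: supportedN; apply: supported_sum => j _.
have -> : (m + N.+1 = m + (N.+1 - j.+1) + j.+1)%N by have := ltn_ord j; lia.
apply: (supported_heisN (P := D (m + (N.+1 - j.+1))%N)) => [x i|]; first exact: DP.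
by apply: IH; have := ltn_ord j; lia.
Qed.

Lemma VL_gen_latdeg s a : supported (fun x => x.1 = a) (VL_gen s a).
Proof.
elim: s => [|p s IH]; first exact: supportedU.
exact: (@supported_s_op (fun _ x => x.1 = a) _ _ 0).
Qed.

Lemma Y_iota_gen a s b k : exists N0 : nat, forall N : nat, (N0 <= N)%N ->
  Y k (iota_e a) (VL_gen s b) = \sum_(q < N)
    match q%:Z - k - 1 - form a b with
    | Posz p => s_op (- a) p (exp_ann a q (cocycle E a b *: VL_gen s (a + b)))
    | Negz _ => 0
    end.
Proof.
have [N0 H] := lva_exp hY a k (VL_gen_latdeg (s := s) (a := b)).
exists N0 => N leN; rewrite (H N leN); apply: eq_bigr => q _.
case: (q%:Z - k - 1 - form a b) => [p|//].
by rewrite exp_creationE e_act_gen.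
Qed.

Definition preserves_VL u := forall k v, v \in VL_pred alpha ->
  Y k u v \in VL_pred alpha.

Let va := lva_va hY.

Lemma preserves_VL_zspan u : zspan preserves_VL u -> preserves_VL u.
Proof.
move=> Wu; apply: (Wu preserves_VL) => // [k v _|x y Wx Wy k v vVL].
  by rewrite (Y0l va) rpred0.
by rewrite (YBl va) rpredB ?Wx ?Wy.
Qed.

Lemma preserves_VL_product k u v :
  preserves_VL u -> preserves_VL v -> preserves_VL (Y k u v).
Proof.
move=> Wu Wv m w wVL; have [N H] := va_iterate va k m u v w.
rewrite (H N) //; apply: rpred_sum => i _; apply: rpredMz; apply: rpredB.
  by apply: (Wu); apply: (Wv).
by apply: rpredMz; apply: (Wv); apply: (Wu).
Qed.

Lemma preserves_VL_sign (e : rat) u : e = 1 \/ e = -1 ->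
  preserves_VL (e *: u) -> preserves_VL u.
Proof.
case=> ->; rewrite ?scale1r // scaleN1r => Wu k v vVL.
by rewrite -[u]opprK -sub0r (YBl va) (Y0l va) sub0r rpredN Wu.
Qed.

Lemma zspan_sign (P : V -> Prop) (e : rat) u : e = 1 \/ e = -1 -> zspan P u -> zspan P (e *: u).
Proof. by case=> ->; rewrite ?scale1r // scaleN1r; apply: zspanN. Qed.

Lemma preserves_VL_iota a : preserves_VL (iota_e a).
Proof.
move=> k v /VL_zspan vVL.
apply: (vVL (fun v => Y k (iota_e a) v \in VL_pred alpha)).
- by rewrite (Y0r va) rpred0.
- by move=> u w Wu Ww; rewrite (YBr va) rpredB.
move=> _ [s [b ->]]; have [N H] := Y_iota_gen a s b k; rewrite (H N) //.
apply: rpred_sum => q _; case: (q%:Z - k - 1 - form a b) => [p|_]; last exact: rpred0.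
apply: s_op_VL; rewrite [exp_ann _ _ (_ *: _)]linearZ /=.
apply: (zspan_VL (P := fun u => exists s' c, u = VL_gen s' c)).
  by move=> _ [s' [c ->]]; apply: VL_gen_in.
apply: zspan_sign; first exact: cocycle_sign.
apply: (zspan_trans _ (@exp_ann_gen a q s (a + b))) => u [s' [_ _ ->]].
by apply: zspan_gen; exists s', (a + b).
Qed.

(* The product of [e_(-b)] and an element of lattice degree [a + b] has
   leading term [s_(b, N)] times the latter, and the other terms of lower
   weight; this gives an induction on the weight. *)
Lemma preserves_VL_gen s a : preserves_VL (VL_gen s a).
Proof.
elim: {s}(size s) {-2}s (erefl (size s)) a => [|l IHl] s.
  by move/size0nil=> -> a; apply: preserves_VL_iota.
case: s => // -[b N] s [sz] a; rewrite VL_gen_cons /=.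
(* Induction on the weight of the tail s alone, with N arbitrary: in the corrections the index N
   grows while the weight of the tail drops. *)
elim/ltn_ind: {s}(gen_weight s) {-2}s (erefl (gen_weight s)) sz N => w IHw s wt sz N.
(* With this k the creation exponent of the term q is N + q, so q = 0 gives s_(b, N) on the given
   tail, up to the cocycle sign. *)
pose k := - N%:Z - 1 - form (- b) (b + a).
have W1 : preserves_VL (Y k (iota_e (- b)) (VL_gen s (b + a))).
  by apply: preserves_VL_product; [apply: preserves_VL_iota | apply: IHl].
have [M H] := Y_iota_gen (- b) s (b + a) k.
move: W1; rewrite (H M.+1) // big_ord_recl /= addKr opprK.
have kE (q : nat) : q%:Z - k - 1 - form (- b) (b + a) = (N + q)%:Z by rewrite /k; lia.
rewrite kE exp_ann0 addn0 => W1.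
apply: (preserves_VL_sign (cocycle_sign (- b) (b + a))).
rewrite -[_ *: _]linearZ /=.
move: W1; set X := s_op b N _; set S := \sum_(i < M) _ => W1.
rewrite -[X](addrK S); apply: preserves_VL_zspan; apply: zspanB; first exact: zspan_gen.
apply: zspan_sum => i _; rewrite kE [exp_ann _ _ (_ *: _)]linearZ /=.
rewrite [s_op _ _ (_ *: _)]linearZ /=; apply: zspan_sign; first exact: cocycle_sign.
apply: (zspan_additive _ (@exp_ann_gen (- b) _ s a)) => u [s' [sz' wt' ->]].
apply: zspan_gen; apply: (IHw (gen_weight s')) => //; last by rewrite sz'.
by rewrite -wt -wt' /bump; lia.
Qed.

Lemma product_in_VL k u v : u \in VL_pred alpha -> v \in VL_pred alpha ->
  Y k u v \in VL_pred alpha.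
Proof.
move=> /VL_zspan uVL vVL; have Wu : preserves_VL u.
  apply: preserves_VL_zspan; apply: (zspan_trans _ uVL) => _ [s [a ->]].
  by apply: zspan_gen; exact: preserves_VL_gen.
exact: Wu.
Qed.
End Closure.

(** * The Virasoro relations over the rationals *)

Lemma mset_ind (T : choiceType) (P : {mset T} -> Prop) :
  P mset0 -> (forall x mu, P mu -> P (x +` mu)) -> forall mu, P mu.
Proof.
move=> P0 PS mu; rewrite -(seq_mset_id mu); elim: (enum_mset mu) => [|x s IH].
  by rewrite (_ : seq_mset _ = mset0) //; apply/msetP => y; rewrite mset_seqE mset0E.
rewrite (_ : seq_mset _ = x +` seq_mset s); first exact: PS.
by apply/msetP => y; rewrite mset1DE !mset_seqE /= eq_sym.
Qed.

Lemma binz1l i : binz 1 i.+2 = 0.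
Proof. by rewrite /binz !big_ord_recl /= subrr mul0r mulr0 div0z. Qed.

(** Contracting omega through either of its two indices gives the same vector; the factor 1/2
    averages the two results. *)
Lemma half_sumD (V : lmodType rat) (I J : finType) (A B : I -> J -> V) x :
  \sum_i \sum_j A i j = x -> \sum_i \sum_j B i j = x ->
  \sum_i \sum_j 2%:R^-1 *: (A i j + B i j) = x.
Proof.
move=> Ax Bx; under eq_bigr => i _ do rewrite -scaler_sumr big_split.
rewrite -scaler_sumr big_split /= Ax Bx -mulr2n -scaler_nat scalerA.
by rewrite mulVf ?scale1r.
Qed.

Lemma half_scaleD (V : lmodType rat) (h s t : rat) (x y : V) :
  (h / 2%:R) *: (s *: x + t *: y) = 2%:R^-1 *: ((s * h) *: x + (t * h) *: y).
Proof.
rewrite !scalerDr !scalerA; congr (_ *: _ + _ *: _); ring.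
Qed.

(** * The Gram matrix and dual bases *)

Section Gram.
Context {L : evenLattice} {n : nat}.
Variable alpha : lattice_basis L n.
Local Notation G := (map_mx intr (gram alpha) : 'M[rat]_n).
Local Notation H := (gram_inv alpha).

(** A kernel vector of G is the coordinate vector of a lattice element orthogonal to a basis, which
    nondegeneracy forces to be zero. *)
Lemma det_gram_neq0 : \det (gram alpha) != 0.
Proof.
apply/negP => /det0P [v v0 vG]; case/negP: v0.
have a0 : \sum_i alpha i *~ v 0 i = 0.
  apply: form_nondegenerate => b; rewrite -(coordK alpha b) formC form_suml.
  apply: big1 => j _; rewrite formMzl formC form_suml.
  have /rowP/(_ j) := vG; rewrite !mxE => vGj.
  have -> : \sum_i form (alpha i *~ v 0 i) (alpha j) = 0.
    by rewrite -[RHS]vGj; apply: eq_bigr => i _; rewrite formMzl mxE mulrC.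
  by rewrite mul0r.
apply/eqP; rewrite -(basK alpha v) a0 -(subrr (0 : L)) coordD coordN subrr.
by [].
Qed.

Lemma gramQ_unit : G \in unitmx.
Proof. by rewrite unitmxE det_map_mx unitfE intr_eq0 det_gram_neq0. Qed.

Lemma gram_sym : (gram alpha)^T = gram alpha.
Proof. by apply/matrixP => i j; rewrite !mxE formC. Qed.

Lemma gram_inv_sym i j : H i j = H j i.
Proof.
by rewrite -[in RHS](_ : H^T = H) ?mxE // trmx_inv map_trmx gram_sym.
Qed.

Lemma formQ_gram_inv (b : 'rV_n) j :
  \sum_i formQ alpha b (alpha i) * H i j = b 0 j.
Proof.
rewrite -[b in RHS]mulmx1 -(mulmxV gramQ_unit) mulmxA mxE.
apply: eq_bigr => i _; rewrite mxE; congr (_ * _); apply: eq_bigr => k _.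
by rewrite !mxE.
Qed.
End Gram.

Section Virasoro.
Context {L : evenLattice} {n : nat}.
Variables (alpha : lattice_basis L n) (E : central_extension L).
Local Notation K := (lat L * {mset ('I_n * nat)})%type.
Local Notation V := (VLQ L n).
Local Notation formQ := (formQ alpha).
Local Notation toQ := (toQ alpha).
Local Notation heis := (heis alpha).
Local Notation iota_e := (@iota_e L n).
Local Notation vacQ := (@vacQ L n).
Local Notation H := (gram_inv alpha).
Implicit Types (a : L) (b c : 'rV[rat]_n) (v : V).

Variable Y : int -> V -> V -> V.
Hypothesis hY : is_lattice_va alpha E Y.
Let va := lva_va hY.

(** Expansion b = sum_i (b, alpha_i) alpha_i^*, where alpha_i^* = sum_j H_ij alpha_j is the dual
    basis. *)
Lemma sum_gram_inv_heis b k v :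
  \sum_i \sum_j (formQ b (alpha i) * H i j) *: heis (toQ (alpha j)) k v = heis b k v.
Proof.
rewrite exchange_big /=.
have {2}-> : b = \sum_j b 0 j *: toQ (alpha j).
  apply/rowP => l; rewrite summxE (bigD1 l) //= big1 => [|j ne].
    by rewrite toQ_bas !mxE !eqxx mulr1 addr0.
  by rewrite toQ_bas !mxE eqxx eq_sym (negbTE ne) mulr0.
rewrite heis_suml; apply: eq_bigr => j _; rewrite -scaler_suml.
by rewrite formQ_gram_inv.
Qed.

Lemma sum_gram_inv_heis_sym b k v :
  \sum_i \sum_j (formQ b (alpha j) * H i j) *: heis (toQ (alpha i)) k v = heis b k v.
Proof.
rewrite exchange_big -[RHS]sum_gram_inv_heis; apply: eq_bigr => i _.
by apply: eq_bigr => j _; rewrite gram_inv_sym.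
Qed.

Definition omegaQ : V := \sum_i \sum_j (H i j / 2%:R) *: heis2Q alpha i j.

(** Half the trace of H G, that is n / 2. As a double sum it has its denominators cleared in the
    same way as omega. *)
Definition half_charge : rat :=
  \sum_i \sum_j (H i j / 2%:R) * (form (alpha i) (alpha j))%:~R.

Lemma omega_ind (f : {linear V -> V}) :
  f omegaQ = \sum_i \sum_j (H i j / 2%:R) *: f (heis2Q alpha i j).
Proof.
rewrite linear_sum; apply: eq_bigr => i _; rewrite linear_sum; apply: eq_bigr => j _.
exact: linearZ.
Qed.

Lemma heis_heis2 b (k : nat) i j : heis b k%:Z (heis2Q alpha i j)
  = if k == 1%N then formQ b (alpha j) *: heis (toQ (alpha i)) (-1) vacQ
                     + formQ b (alpha i) *: heis (toQ (alpha j)) (-1) vacQ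
    else 0.
Proof.
have /eqP := heis_commutator hY b (toQ (alpha i)) k%:Z (-1)
  (heis (toQ (alpha j)) (-1) vacQ).
rewrite subr_eq => /eqP ->.
case: k => [|k]; first by rewrite add0r (heis0_heisN _ _ _ 0) scale0r add0r linear0.
rewrite (heisP_heisN _ _ _ k) !bformQ_toQ.
case: k => [|k].
  by rewrite /= [heis _ _ (_ *: _)]linearZ /= mul1r [LHS]addrC.
have -> : (k.+2%:Z + -1 == 0) = false by lia.
by rewrite /= !scale0r add0r; exact: linear0.
Qed.

Lemma heis_omega b (k : nat) :
  heis b k%:Z omegaQ = if k == 1%N then heis b (-1) vacQ else 0.
Proof.
rewrite omega_ind /=; case: ifP => k1; last first.
  by rewrite big1 // => i _; rewrite big1 // => j _; rewrite heis_heis2 k1 scaler0.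
rewrite -[RHS](half_sumD (sum_gram_inv_heis_sym b (-1) vacQ)
  (sum_gram_inv_heis b (-1) vacQ)).
apply: eq_bigr => i _; apply: eq_bigr => j _.
by rewrite heis_heis2 k1 half_scaleD.
Qed.

Lemma heis_vir b m k v :
  heis b m (Y (k + 1) omegaQ v) - Y (k + 1) omegaQ (heis b m v)
  = m%:~R *: heis b (m + k) v.
Proof.
rewrite -[in X in X - _](lva_heis hY) -[heis b m v](lva_heis hY).
rewrite (@va_commutator_trunc _ _ _ _ va 2) => [|[|[|i]] // _]; last first.
  by rewrite (lva_heis hY) heis_omega.
rewrite !big_ord_recl big_ord0 /= !(lva_heis hY) !heis_omega /= (Y0l va) mul0rz.
by rewrite add0r addr0 binz1r (lva_heis hY) scaler_int addrA addrK.
Qed.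

Lemma heis2_product i j : heis2Q alpha i j
  = Y (-1) (heis (toQ (alpha i)) (-1) vacQ) (heis (toQ (alpha j)) (-1) vacQ).
Proof. by rewrite (lva_heis hY). Qed.

(** Positive modes kill iota(e_a), so normal ordering leaves only alpha_j(0) alpha_i(0), and
    contraction with H yields (a, a) / 2. *)
Lemma vir_iota0 a : Y 1 omegaQ (iota_e a) = ((form a a)%:~R / 2%:R) *: iota_e a.
Proof.
have term i j : Y 1 (heis2Q alpha i j) (iota_e a)
    = (formQ (toQ a) (alpha i) * formQ (toQ (alpha j)) a) *: iota_e a.
  rewrite heis2_product.
  have Yi := lva_heis hY (toQ (alpha i)); have Yj := lva_heis hY (toQ (alpha j)).
  move: (heis (toQ (alpha i)) (-1) vacQ) (heis (toQ (alpha j)) (-1) vacQ) Yi Yj => hi hj Yi Yj.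
  rewrite (va_normal_order2 va) => [|l|l]; rewrite !(Yi, Yj) ?heis_iota_pos //.
  rewrite subrr linear0 add0r heis_iota0.
  rewrite [heis _ _ (_ *: _)]linearZ /= heis_iota0 scalerA !formQ_toQ.
  by rewrite (formC a).
rewrite (Y_suml va); under eq_bigr => i _ do rewrite (Y_suml va).
rewrite -(formQ_toQ alpha) -bformQ_toQ /bformQ mulr_suml scaler_suml exchange_big.
apply: eq_bigr => j _ /=.
rewrite -(formQ_gram_inv alpha) !mulr_suml scaler_suml; apply: eq_bigr => i _.
rewrite (YZl va) term scalerA [formQ (toQ (alpha j)) a]formQ_toQ (formC (alpha j)) -(formQ_toQ alpha).
by congr (_ *: _); ring.
Qed.

(** In each surviving term one factor acts by its zero mode and the other by its mode -1. *)
Lemma vir_iotaN1 a : Y 0 omegaQ (iota_e a) = heis (toQ a) (-1) (iota_e a).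
Proof.
have term i j : Y 0 (heis2Q alpha i j) (iota_e a)
    = formQ (toQ a) (alpha j) *: heis (toQ (alpha i)) (-1) (iota_e a)
    + formQ (toQ a) (alpha i) *: heis (toQ (alpha j)) (-1) (iota_e a).
  rewrite heis2_product.
  have Yi := lva_heis hY (toQ (alpha i)); have Yj := lva_heis hY (toQ (alpha j)).
  move: (heis (toQ (alpha i)) (-1) vacQ) (heis (toQ (alpha j)) (-1) vacQ) Yi Yj => hi hj Yi Yj.
  rewrite (va_normal_order2 va) => [|l|l]; rewrite !(Yi, Yj).
  - rewrite !heis_iota0 sub0r ![heis _ _ (_ *: _)]linearZ /= !formQ_toQ.
    by rewrite !(formC a).
  - by rewrite heis_iota_pos.
  by rewrite add0r heis_iota_pos.
rewrite (Y_suml va); under eq_bigr => i _ do rewrite (Y_suml va).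
rewrite -[RHS](half_sumD (sum_gram_inv_heis_sym (toQ a) (-1) (iota_e a))
  (sum_gram_inv_heis (toQ a) (-1) (iota_e a))).
apply: eq_bigr => i _; apply: eq_bigr => j _.
by rewrite (YZl va) term half_scaleD.
Qed.

(** At k = -2 the creation exponent is q + 1. On the vacuum only q = 0 contributes, with the first
    coefficient a(-1) of the exponential. *)
Lemma translation_iota a : Y (-2) (iota_e a) vacQ = heis (toQ a) (-1) (iota_e a).
Proof.
have [N eqN] := lva_exp hY a (-2) (@supportedU _ _ (fun x => x.1 = 0) (0, mset0) erefl).
rewrite (eqN N.+1) // form0r e_actU cocycle0 scale1r addr0 big_ord_recl big1.
  by rewrite addr0 exp_ann0 exp_creationE s_op1 toQN heisNl opprK.
move=> q _; rewrite -/(iota_e a) (exp_ann_iota hY).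
by rewrite exp_creationE; exact: linear0.
Qed.

(** Induction on monomials in terms of operators, suited to commutators with b(m): a creation
    operator of a basis element appends one factor. *)
Lemma VLQ_ind (S : V -> Prop) :
  (forall t u v, S u -> S v -> S (t *: u + v)) -> (forall a, S (iota_e a)) ->
  (forall i m v, S v -> S (heis (delta_mx 0 i) (Negz m) v)) -> forall v, S v.
Proof.
move=> Slin Se Sheis v; have S0 : S 0.
  by have := Slin (-1) _ _ (Se 0) (Se 0); rewrite scaleN1r addNr.
rewrite (malg_sum v); apply: big_ind => // [u w Su Sw|x _].
  by rewrite -[u]scale1r; apply: (Slin).
suff Sx : S << x >> by rewrite -[_ *: _]addr0; apply: (Slin).
case: x => a mu; elim/mset_ind: mu => [|[i m] mu IH]; first exact: Se.
by have := Sheis i m _ IH; rewrite heisN_deltaU.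
Qed.

Lemma vir_heis b m k v : Y (k + 1) omegaQ (heis b m v)
  = heis b m (Y (k + 1) omegaQ v) - m%:~R *: heis b (m + k) v.
Proof. by rewrite -heis_vir opprB addrCA subrr addr0. Qed.

(** L_(-1) and T agree on every iota(e_a) and have the same commutator with each b(m), the latter by
    [translationP]. *)
Lemma vir_translation v : Y 0 omegaQ v = Y (-2) v vacQ.
Proof.
elim/VLQ_ind: v => [t u v IHu IHv|a|i m v IH].
- by rewrite (va_linr va) (va_linl va) IHu IHv.
- by rewrite vir_iotaN1 translation_iota.
rewrite -[RHS](congr1 (fun w => Y (-2) w vacQ) (lva_heis hY _ (Negz m) v)).
rewrite (translationP va) !(lva_heis hY).
by rewrite (vir_heis _ _ (-1)) IH scaler_int.
Qed.

(** By the commutator formula at m = 0, omega_0 is a derivation of all products. Comparison with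
    [translationP] leaves (T u)_k = - k u_(k-1). *)
Lemma translation_product k u v :
  Y k (Y (-2) u vacQ) v = - (Y (k - 1) u v *~ k).
Proof.
have [N eqN] := va_commutator va 0 k omegaQ u v.
have := eqN N.+1 (leqnSn N); rewrite big_ord_recl big1 => [|l _]; last first.
  by rewrite binz0l mulr0z.
rewrite binz0r mulr1z /= addr0 add0r subr0 !vir_translation (translationP va).
by rewrite addrAC subrr add0r => <-.
Qed.

Definition key_degree (x : K) : int :=
  (mset_weight x.2)%:Z + (form x.1 x.1 %/ 2)%Z.

Lemma mset_weight0 : mset_weight (mset0 : {mset ('I_n * nat)}) = 0%N.
Proof. by rewrite /mset_weight finsupp0 big_seq_fset0. Qed.

Lemma mset_weightD1 (i : 'I_n) m mu :
  mset_weight ((i, m) +` mu) = (m.+1 + mset_weight mu)%N.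
Proof.
pose D := finsupp ((i, m) +` mu).
have sub : (finsupp mu `<=` D)%fset.
  by apply/fsubsetP => x; rewrite !msuppE in_mset1D => ->; rewrite orbT.
rewrite /mset_weight -/D (big_fset_incl _ sub) => [|x _]; last first.
  by rewrite mem_finsupp negbK => /eqP ->; rewrite mul0n.
under eq_bigr => x _ do rewrite mset1DE mulnDl.
rewrite big_split /=; congr (_ + _)%N.
rewrite (big_fsetD1 (i, m)) /=; last by rewrite /D msuppE in_mset1D eqxx.
rewrite eqxx mul1n big1_seq ?addn0 // => x; rewrite !inE => /andP[_ /andP[/negbTE-> _]].
by rewrite mul0n.
Qed.

Lemma key_degree_cons a i m mu :
  key_degree (a, (i, m) +` mu) = m.+1%:Z + key_degree (a, mu).
Proof. by rewrite /key_degree mset_weightD1 PoszD addrA. Qed.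

Lemma vir0_basis x : Y 1 omegaQ << x >> = (key_degree x)%:~R *: << x >>.
Proof.
case: x => a mu; elim/mset_ind: mu => [|[i m] mu IH].
  rewrite /key_degree mset_weight0 add0r [LHS]vir_iota0; congr (_ *: _).
  (* Evenness identifies the rational eigenvalue (a, a) / 2 with the integer quotient in the
     degree. *)
  have /dvdzP [d ->] := form_even a.
  by rewrite mulzK // rmorphM /= mulfK.
rewrite -(heisN_deltaU alpha i m (a, mu)).
rewrite (vir_heis _ _ 0) add0r IH [heis _ _ (_ *: _)]linearZ /= addr0 key_degree_cons.
rewrite -scalerBl -rmorphB; congr (_%:~R *: _).
by rewrite NegzE opprK addrC.
Qed.

Lemma mcoeff_vir0 v x : (Y 1 omegaQ v)@_x = (key_degree x)%:~R * v@_x.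
Proof.
rewrite [in LHS](malg_sum v) [in RHS](malg_sum v) (Y_sumr va) !raddf_sum mulr_sumr.
apply: eq_bigr => y _ /=; rewrite (YZr va) vir0_basis !mcoeffZ mcoeffU.
by case: eqP => [->|]; rewrite ?mulr0 // mulrCA.
Qed.

(** L_0 is diagonal on monomials, so homogeneity becomes an eigenvector equation, to which the
    commutator formula applies. *)
Lemma degQP d v : degQ d v <-> Y 1 omegaQ v = d%:~R *: v.
Proof.
split=> [dv|eqv x xv].
  apply/malgP => x; rewrite mcoeff_vir0 mcoeffZ.
  by case: msuppP => [/dv <-//|]; rewrite !mulr0.
have /malgP/(_ x) := eqv; rewrite mcoeff_vir0 mcoeffZ => /eqP.
rewrite -subr_eq0 -mulrBl mulf_eq0 mcoeff_eq0 xv orbF -rmorphB intr_eq0 subr_eq0.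
by move/eqP.
Qed.

(** [L_0, u_k] = (T u)_(k+1) + (L_0 u)_k = (d - k - 1) u_k. *)
Lemma product_degree d e k u v :
  degQ d u -> degQ e v -> degQ (d + e - k - 1) (Y k u v).
Proof.
move=> /degQP du /degQP ev; apply/degQP.
have [N eqN] := va_commutator va 1 k omegaQ u v.
have := eqN N.+2 (leqW (leqnSn N)).
rewrite !big_ord_recl big1 => [|l _]; last by rewrite binz1l mulr0z.
rewrite binz0r binz1r !mulr1z /= !(subr0, addr0) vir_translation translation_product.
rewrite du (YZl va) ev (YZr va) => /eqP; rewrite subr_eq => /eqP ->.
have -> : 1 + k - 1 = k by lia.
rewrite -scaler_int -scaleNr -!scalerDl; congr (_ *: _).
by rewrite -rmorphN -!rmorphD /=; congr (_%:~R); lia.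
Qed.

Lemma vir_heis2 (k : nat) i j : Y (k%:Z + 1) omegaQ (heis2Q alpha i j)
  = match k with
    | 0%N => 2%:R *: heis2Q alpha i j
    | 2%N => (form (alpha i) (alpha j))%:~R *: vacQ
    | _ => 0
    end.
Proof.
rewrite /heis2Q !vir_heis.
have -> : Y (k%:Z + 1) omegaQ vacQ = 0 by rewrite -PoszD (va_create va).
rewrite linear0 sub0r !mulrN1z !scaleN1r opprK [- - heis _ _ _]opprK.
case: k => [|[|k]].
- by rewrite (_ : -1 + 0%:Z = -1) // scaler_nat mulr2n.
- by rewrite !subrr (heis0_heisN _ _ _ 0) (@heis_iota0 _ _ alpha) formQ0 scale0r linear0 addr0.
have -> : -1 + k.+2%:Z = k.+1 by lia.
rewrite heis_iota_pos linear0 add0r heisP_heisN.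
by case: k => [|k]; rewrite ?scale0r // bformQ_toQ formQ_toQ.
Qed.

Lemma vir_omega (k : nat) : Y (k%:Z + 1) omegaQ omegaQ
  = match k with
    | 0%N => 2%:R *: omegaQ
    | 2%N => half_charge *: vacQ
    | _ => 0
    end.
Proof.
rewrite {2}/omegaQ (Y_sumr va).
under eq_bigr => i _.
  rewrite (Y_sumr va); under eq_bigr => j _ do rewrite (YZr va) vir_heis2.
  over.
case: k => [|[|[|k]]].
- rewrite /omegaQ scaler_sumr; apply: eq_bigr => i _.
  rewrite scaler_sumr; apply: eq_bigr => j _.
  by rewrite !scalerA mulrC.
- by rewrite big1 // => i _; rewrite big1 // => j _; rewrite scaler0.
- rewrite /half_charge scaler_suml; apply: eq_bigr => i _.
  by rewrite scaler_suml; apply: eq_bigr => j _; rewrite scalerA.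
by rewrite big1 // => i _; rewrite big1 // => j _; rewrite scaler0.
Qed.

Lemma virasoro m k v :
  Y (m + 1) omegaQ (Y (k + 1) omegaQ v) - Y (k + 1) omegaQ (Y (m + 1) omegaQ v)
  = (m - k)%:~R *: Y (m + k + 1) omegaQ v
    + (if m + k == 0 then (binz (m + 1) 3)%:~R * half_charge else 0) *: v.
Proof.
rewrite (@va_commutator_trunc _ _ _ _ va 4) => [|[|[|[|[|i]]]] // _]; last first.
  by rewrite -[i.+4]addn1 PoszD vir_omega.
rewrite !big_ord_recl big_ord0 /= /bump /= binz0r binz1r.
rewrite vir_translation translation_product.
rewrite (vir_omega 0) (vir_omega 1) (vir_omega 2) (Y0l va) mul0rz add0r !(YZl va).
rewrite (va_vac va) !addr0 addrA; congr (_ + _).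
  (* The coefficient - (m + k + 2) from T omega and 2 (m + 1) from L_0 omega = 2 omega add up to m -
     k. *)
  have -> : m + 1 + (k + 1) - 1 = m + k + 1 by lia.
  rewrite mulr1z -!scaler_int !scalerA -scaleNr -scalerDl; congr (_ *: _).
  by rewrite -[2%:R]/(2%:~R) -rmorphM -rmorphN -rmorphD /=; congr (_%:~R); lia.
have -> : (m + 1 + (k + 1) - 3 == -1) = (m + k == 0) by lia.
case: ifP => _; last by rewrite scaler0 mul0rz scale0r.
by rewrite -scaler_int scalerA.
Qed.
End Virasoro.

(** * Degree pieces of the integral form *)

Section SubgroupSection.
Variable M : zmodType.
Implicit Types (H : M -> Prop) (x : M -> int).

(** Additivity is asked on H only: the functionals applied later are floors, additive where the
    values are integers. *)
Definition additive_on H x := forall u v, H u -> H v -> x (u - v) = x u - x v.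

Lemma additive_on0 H x : H 0 -> additive_on H x -> x 0 = 0.
Proof. by move=> H0 /(_ 0 0 H0 H0); rewrite !subrr. Qed.

Lemma subgroupMz H v z : H 0 -> (forall u v, H u -> H v -> H (u - v)) ->
  H v -> H (v *~ z).
Proof.
move=> H0 HB Hv; have HN w : H w -> H (- w) by rewrite -sub0r; apply: HB.
have HM m : H (v *+ m).
  by elim: m => // m IH; rewrite mulrS -[v *+ m]opprK; apply: HB => //; apply: HN.
by case: z => m; rewrite ?NegzE ?mulrNz; [|apply: HN]; apply: HM.
Qed.

Lemma additive_onMz H x v z : H 0 -> (forall u v, H u -> H v -> H (u - v)) ->
  additive_on H x -> H v -> x (v *~ z) = x v * z.
Proof.
move=> H0 HB xB Hv; have x0 := additive_on0 H0 xB.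
have xN w : H w -> x (- w) = - x w by move=> Hw; rewrite -[- w]sub0r xB // x0 sub0r.
have xM m : x (v *~ m%:Z) = x v * m%:Z.
  elim: m => [|m IH]; first by rewrite mulr0z mulr0.
  have -> : v *~ m.+1%:Z = v *~ m%:Z - (- v).
    by rewrite opprK -addn1 PoszD mulrzDr mulr1z.
  rewrite xB; [|exact: subgroupMz|by rewrite -[- v]sub0r; apply: HB].
  by rewrite IH xN // opprK -[m.+1]addn1 PoszD mulrDr mulr1.
by case: z => m //; rewrite NegzE mulrNz mulrN xN ?xM //; apply: subgroupMz.
Qed.

(* Subgroups of a lattice are free; here the lattice is presented by a jointly
   injective family of integer-valued functionals. *)
Lemma subgroup_coordinates H (x : nat -> M -> int) m :
  H 0 -> (forall u v, H u -> H v -> H (u - v)) ->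
  (forall i, (i < m)%N -> additive_on H (x i)) ->
  (forall v, H v -> (forall i, (i < m)%N -> x i v = 0) -> v = 0) ->
  exists (N : nat) (g : nat -> M) (c : nat -> M -> int),
    [/\ forall i, H (g i), forall i, additive_on H (c i)
      & forall v, H v -> v = \sum_(i < N) g i *~ c i v].
Proof.
elim: m H => [|m IH] H H0 HB xB xI.
  exists 0%N, (fun=> 0), (fun _ _ => 0); split=> // v Hv.
  by rewrite big_ord0; apply: xI.
have xmB := xB m (ltnSn m); have xm0 := additive_on0 H0 xmB.
(* The kernel of the last functional has generators by induction; unless it is all of H, one more
   generator is needed. *)
pose H' v := H v /\ x m v = 0.
have [||||N [g [c [Hg cB vE]]]] := IH H'.
- by split.
- by move=> u v [Hu u0] [Hv v0]; split; [apply: HB | rewrite xmB // u0 v0].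
- by move=> i lt u v [Hu _] [Hv _]; apply: xB => //; apply: ltnW.
- move=> v [Hv v0] vI; apply: xI => // i; rewrite ltnS leq_eqVlt.
  by case/orP => [/eqP->//|]; apply: vI.
pose P k := `[< (0 < k)%N /\ exists2 v, H v & `|x m v|%N = k >].
have [[k0 Pk0]|noP] := pselect (exists k, P k); last first.
  have HH' v : H v -> H' v.
    move=> Hv; split=> //; apply: contrapT => /eqP xv; case: noP.
    by exists `|x m v|%N; apply/asboolP; split; [rewrite absz_gt0 | exists v].
  exists N, g, c; split=> [i|i u v Hu Hv|v Hv]; first by case: (Hg i).
    by apply: cB; apply: HH'.
  by apply: vE; apply: HH'.
case: (ex_minnP (ex_intro _ k0 Pk0)) => k /asboolP[k_gt0 [g0 Hg0 xg0]] kmin.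
have d0 : x m g0 != 0 by rewrite -absz_gt0 xg0.
pose c0 v := (x m v %/ x m g0)%Z.
have Hsub v : H v -> H (v - g0 *~ c0 v).
  by move=> Hv; apply: (HB) => //; apply: subgroupMz.
have c0E v : H v -> x m v = c0 v * x m g0.
  move=> Hv; rewrite [LHS](divz_eq _ (x m g0)) -/(c0 v).
  suff -> : (x m v %% x m g0)%Z = 0 by rewrite addr0.
  (* A nonzero remainder would be a value of the functional on H of smaller absolute value than the
     minimal one at g0. *)
  apply/eqP/negP => /negP r0.
  have rE : x m (v - g0 *~ c0 v) = (x m v %% x m g0)%Z.
    rewrite xmB //; last exact: subgroupMz.
    by rewrite (additive_onMz _ H0 HB xmB) // /modz mulrC.
  have := kmin `|(x m v %% x m g0)%Z|%N.
  rewrite leqNgt -xg0 (_ : (_ < _)%N); last first.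
    by have := ltz_mod (x m v) d0; have := modz_ge0 (x m v) d0; lia.
  move=> /(_ _)/negP; apply=> //; apply/asboolP; split; first by rewrite absz_gt0.
  by exists (v - g0 *~ c0 v); [apply: Hsub | rewrite rE].
have H'sub v : H v -> H' (v - g0 *~ c0 v).
  move=> Hv; split; first exact: Hsub.
  rewrite xmB //; last exact: subgroupMz.
  by rewrite (additive_onMz _ H0 HB xmB) // mulrC -c0E // subrr.
have c0B : additive_on H c0.
  move=> u v Hu Hv; apply: (mulIf d0).
  by rewrite -c0E; [rewrite mulrBl -!c0E // xmB | apply: HB].
exists N.+1, (fun i => if i is j.+1 then g j else g0).
exists (fun i v => if i is j.+1 then c j (v - g0 *~ c0 v) else c0 v); split.
- by case=> [//|i]; case: (Hg i).
- case=> [|i] u v Hu Hv; first exact: c0B.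
  rewrite -cB; [|exact: H'sub|exact: H'sub]; congr (c i _).
  by rewrite c0B // mulrzBr !opprB addrACA [RHS]addrACA; congr (_ + _); rewrite addrC.
move=> v Hv; rewrite big_ord_recl /= -(vE _ (H'sub v Hv)) addrC subrK.
by [].
Qed.
End SubgroupSection.

(** * Homogeneous components and denominators *)

Section DegreePieces.
Context {L : evenLattice} {n : nat}.
Variables (alpha : lattice_basis L n) (E : central_extension L).
Local Notation K := (lat L * {mset ('I_n * nat)})%type.
Local Notation V := (VLQ L n).
Local Notation toQ := (toQ alpha).
Local Notation heis := (heis alpha).
Local Notation s_op := (s_op alpha).
Local Notation VL_gen := (VL_gen alpha).
Implicit Types (a b : L) (v : V) (d : int).

Variable Y : int -> V -> V -> V.
Hypothesis hY : is_lattice_va alpha E Y.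

Definition deg_part d (v : V) : V :=
  lin_ext (fun x => if key_degree x == d then << x >> else 0) v.

HB.instance Definition _ d := GRing.isLinear.Build rat V V *:%R (deg_part d)
  (lin_ext_linear (fun x => if key_degree x == d then << x >> else 0)).

Arguments deg_part : simpl never.

Lemma mcoeff_deg_part d v x :
  (deg_part d v)@_x = if key_degree x == d then v@_x else 0.
Proof.
rewrite [in LHS](malg_sum v) linear_sum raddf_sum /=.
have -> : (if key_degree x == d then v@_x else 0)
    = \sum_(y <- msupp v) (if key_degree x == d then (v@_y *: << y >> : V)@_x else 0).
  case: ifP => _; last by rewrite big1.
  by rewrite {1}[v]malg_sum raddf_sum.
apply: eq_bigr => y _; rewrite [deg_part _ (_ *: _)]linearZ /= [deg_part _ _]lin_extU.
rewrite !mcoeffZ mcoeffU; case: (eqVneq y x) => [->|ne].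
  by case: ifP; rewrite ?mcoeffUU ?mcoeff0 ?mulr0.
by case: ifP; case: ifP; rewrite ?mcoeffU ?(negbTE ne) ?mcoeff0 ?mulr0.
Qed.

Lemma deg_part_deg d v : degQ d (deg_part d v).
Proof.
move=> x; rewrite -mcoeff_neq0 mcoeff_deg_part -/(key_degree x).
by case: ifP => [/eqP//|_]; rewrite eqxx.
Qed.

Lemma deg_part_id d e v : degQ e v -> deg_part d v = if e == d then v else 0.
Proof.
move=> dv; apply/malgP => x; rewrite mcoeff_deg_part.
case: (eqVneq e d) => [<-|ne].
  by case: eqP => // ne; case: (msuppP v x) => // /dv.
rewrite mcoeff0; case: eqP => // kd; case: (msuppP v x) => // /dv ek.
by case/eqP: ne; rewrite -ek -kd.
Qed.

Lemma sum_deg_part (ds : seq int) v : uniq ds ->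
  {subset [seq key_degree x | x <- msupp v] <= ds} ->
  v = \sum_(d <- ds) deg_part d v.
Proof.
move=> uds sub; apply/malgP => x; rewrite raddf_sum /=.
under eq_bigr => d _ do rewrite mcoeff_deg_part.
case: (msuppP v x) => [xv|_]; last by rewrite big1 // => d _; case: ifP.
rewrite (bigD1_seq (key_degree x)) //=; last by apply: sub; apply: map_f.
by rewrite eqxx big1 ?addr0 // => d; rewrite eq_sym => /negbTE ->.
Qed.

Lemma VL_gen_degree s a : degQ ((gen_weight s)%:Z + (form a a %/ 2)%Z) (VL_gen s a).
Proof.
elim: s => [|[b N] s IH].
  apply: (@supportedU _ _ (fun x => key_degree x = _)).
  by rewrite /key_degree mset_weight0 /gen_weight big_nil.
pose D k (x : K) := key_degree x = (k + gen_weight s)%:Z + (form a a %/ 2)%Z.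
have DS j k x i : D k x -> D (k + j.+1)%N (x.1, (i, j) +` x.2).
  by rewrite /D key_degree_cons -surjective_pairing => ->; lia.
move=> x xs; have := @supported_s_op _ _ alpha E Y hY D b N 0 (VL_gen s a) DS.
rewrite /gen_weight big_cons; apply=> // y ys; exact: IH.
Qed.

(** The generators of V_L are homogeneous, so a projection fixes or kills each of them. *)
Lemma deg_part_VL d v : v \in VL_pred alpha -> deg_part d v \in VL_pred alpha.
Proof.
move/VL_zspan => vVL; apply: (@zspan_VL _ _ alpha (fun u => u \in VL_pred alpha)) => //.
apply: (zspan_additive (f := deg_part d)) vVL => _ [s [a ->]].
apply: zspan_gen; rewrite /= (deg_part_id _ (@VL_gen_degree s a)).
by case: ifP => _; [apply: VL_gen_in | apply: rpred0].
Qed.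

Definition int_coef (v : V) := forall x, v@_x \is a Num.int.

Lemma int_coef_sum I (r : seq I) (P : pred I) (F : I -> V) :
  (forall i, P i -> int_coef (F i)) -> int_coef (\sum_(i <- r | P i) F i).
Proof. by move=> FP x; rewrite raddf_sum; apply: rpred_sum => i /FP; apply. Qed.

Lemma int_coefZ c v : c \is a Num.int -> int_coef v -> int_coef (c *: v).
Proof. by move=> cZ vZ x; rewrite mcoeffZ rpredM. Qed.

Lemma int_coefN v : int_coef v -> int_coef (- v).
Proof. by move=> vZ x; rewrite mcoeffN rpredN. Qed.

Lemma int_coefU x : int_coef << x >>.
Proof. by move=> y; rewrite mcoeffU natr_int. Qed.

Lemma int_coef_heis a m v : int_coef v -> int_coef (heis (toQ a) (Negz m) v).
Proof.
move=> vZ; rewrite [v]malg_sum linear_sum; apply: int_coef_sum => x _ /=.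
rewrite [heis _ _ (_ *: _)]linearZ /= heisNU; apply: int_coefZ => //.
apply: int_coef_sum => i _; apply: int_coefZ; last exact: int_coefU.
by rewrite mxE rpred_int_num.
Qed.

Lemma int_coef_s_op a N v : int_coef v -> int_coef (N`!%:R *: s_op a N v).
Proof.
move=> vZ; elim/ltn_ind: N => -[|N] IH; first by rewrite scale1r s_op0.
rewrite factS mulnC natrM -scalerA (s_op_rec hY) scalerN scaler_sumr.
apply: int_coefN; apply: int_coef_sum => j _.
have le : (N.+1 - j.+1 <= N)%N by rewrite subSS leq_subr.
(* N! is a falling factorial times (N - j)!, so each term of the recursion receives the factorial
   that clears it. *)
rewrite subSS -(ffact_fact (leq_ord j)) natrM -scalerA -[_ *: heis _ _ _]linearZ /=.
apply: int_coefZ; first exact: natr_int.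
by apply: int_coef_heis; apply: IH; rewrite ltnS leq_subr.
Qed.

Lemma int_coef_VL_gen s a : int_coef ((gen_weight s)`!%:R *: VL_gen s a).
Proof.
elim: s => [|[b N] s IH].
  by rewrite /gen_weight big_nil scale1r; apply: int_coefU.
rewrite VL_gen_cons /gen_weight big_cons /= -/(gen_weight s).
(* (N + w)! is a multiple of N! w!, which splits the denominator between the new factor and the
   tail. *)
rewrite -(bin_fact (leq_addr (gen_weight s) N)) addKn natrM -scalerA.
apply: int_coefZ; first exact: natr_int.
rewrite mulnC natrM -scalerA scalerA mulrC -scalerA -[_ *: s_op _ _ _]linearZ /=.
exact: int_coef_s_op.
Qed.

(** One denominator serves the whole piece: (a, a) >= 0 bounds the weight of a generator of degree d
    by |d|. *)
Lemma int_coef_VL d v : positive_definite L -> v \in VL_pred alpha ->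
  degQ d v -> int_coef ((`|d|%N)`!%:R *: v).
Proof.
move=> pos vVL dv; have <- : deg_part d v = v by rewrite (deg_part_id _ dv) eqxx.
have /VL_zspan vz := vVL.
(* An expression of v may involve generators of other degrees; the projection discards them. *)
apply: (vz (fun u => int_coef ((`|d|%N)`!%:R *: deg_part d u))).
- by move=> x; rewrite linear0 scaler0 mcoeff0 rpred0.
- move=> u w uZ wZ x; rewrite linearB scalerBr mcoeffB.
  by apply: rpredB; [apply: uZ | apply: wZ].
move=> _ [s [a ->]]; rewrite (deg_part_id _ (@VL_gen_degree s a)).
case: eqP => [sd|_]; last by move=> x; rewrite scaler0 mcoeff0 rpred0.
have le : (gen_weight s <= `|d|)%N.
  have a0 : 0 <= form a a.
    have [->|/eqP/pos/ltW//] := eqVneq a 0; by rewrite form0l.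
  have : (0 <= form a a %/ 2)%Z by rewrite divz_ge0.
  by lia.
have /dvdnP [q ->] : ((gen_weight s)`! %| (`|d|%N)`!)%N.
  by rewrite -(bin_fact le) dvdn_mull // dvdn_mulr.
rewrite natrM -scalerA; apply: int_coefZ; first exact: natr_int.
exact: int_coef_VL_gen.
Qed.
End DegreePieces.

Lemma absz_sum_le (I : finType) (F : I -> int) :
  (absz (\sum_i F i)%R <= \sum_i absz (F i))%N.
Proof. by elim/big_rec2: _ => // i x y _; lia. Qed.

(** * Finitely many monomials in each degree *)

Section FinitelyManyKeys.
Context {L : evenLattice} {n : nat}.
Variable alpha : lattice_basis L n.
Hypothesis pos : positive_definite L.
Implicit Types a b : L.

Lemma form_ge0 a : 0 <= form a a.
Proof. by have [->|/eqP/pos/ltW//] := eqVneq a 0; rewrite form0l. Qed.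

Lemma form_Cauchy a b : form a b ^+ 2 <= form a a * form b b.
Proof.
have [->|/eqP/pos b0] := eqVneq b 0; first by rewrite !form0r mulr0.
have := form_ge0 (a *~ form b b - b *~ form a b).
rewrite formDl !formNl !(formDr, formNr) !formMzl !(formC _ (_ *~ _)) !formMzl.
rewrite (formC b a).
move: (form a a) (form b b) (form a b) b0 => x y z y0.
rewrite (_ : _ - _ = y * (x * y - z ^+ 2)); last by ring.
by rewrite pmulr_rge0 // subr_ge0.
Qed.

(** Cauchy-Schwarz together with |z| <= |z|^2 for integers, a crude bound that avoids square
    roots. *)
Lemma form_bound a b : (`|form a b| <= `|form a a| * `|form b b|)%N.
Proof.
have := form_Cauchy a b; have := form_ge0 a; have := form_ge0 b.
move: (form a a) (form b b) (form a b) => [x|//] [y|//] z _ _ H.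
have : (`|z| * `|z| <= x * y)%N by rewrite -lez_nat !PoszM -expr2 abszE real_normK ?num_real.
case: `|z|%N => // m; apply: leq_trans; exact: leq_pmulr.
Qed.

Lemma short_vectors_finite (B : nat) :
  exists s : seq L, forall a, form a a <= B%:Z -> a \in s.
Proof.
(* Cramer's rule: D times the j-th coordinate of a is sum_i (a, alpha_i) adj(G)_ij, and |D| >= 1. *)
pose bound j := (\sum_i B * `|form (alpha i) (alpha i)| * `|(\adj (gram alpha)) i j|)%N.
pose C := (\sum_j bound j)%N.
(* Coordinates in [-C, C] are encoded by ordinals up to 2 C. *)
exists [seq \sum_i alpha i *~ ((f i)%:Z - C%:Z) | f : {ffun 'I_n -> 'I_(C + C).+1}].
move=> a aB; have aB' : (`|form a a| <= B)%N by have := form_ge0 a; lia.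
have coord_bound j : (absz (coord alpha a 0%R j) <= C)%N.
  apply: (@leq_trans (bound j)); last by rewrite /C (bigD1 j) //= leq_addr.
  have := congr1 (fun M : 'rV_n => M 0 j)
    (congr1 (mulmx (coord alpha a)) (mul_mx_adj (gram alpha))).
  rewrite mul_mx_scalar mulmxA !mxE => E1.
  apply: (@leq_trans (absz (\det (gram alpha) * coord alpha a 0 j)%R)).
    by rewrite abszM leq_pmull // absz_gt0 det_gram_neq0.
  rewrite -E1; apply: (leq_trans (absz_sum_le _)).
  apply: leq_sum => i _; rewrite abszM leq_mul2r; apply/orP; right.
  have -> : (coord alpha a *m gram alpha) 0 i = form a (alpha i).
    rewrite -[in RHS](coordK alpha a) form_suml mxE; apply: eq_bigr => k _.
    by rewrite formMzl mxE mulrC.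
  by apply: (leq_trans (form_bound _ _)); rewrite leq_mul2r aB' orbT.
apply/imageP; exists [ffun i => inord (absz (coord alpha a 0%R i + C%:Z)%R)] => //.
rewrite -[LHS](coordK alpha a); apply: eq_bigr => i _; congr (_ *~ _).
have := coord_bound i; rewrite ffunE; move: (coord alpha a 0 i) => z zC.
by rewrite inordK; lia.
Qed.

Lemma light_msets_finite (w : nat) : exists s : seq {mset ('I_n * nat)},
  forall mu, (mset_weight mu <= w)%N -> mu \in s.
Proof.
elim: w => [|w [s sP]].
  exists [:: mset0]; elim/mset_ind => [|[i m] mu _]; first by rewrite mem_head.
  by rewrite mset_weightD1.
exists (mset0 :: [seq (x.1, val x.2) +` mu | x <- enum {: 'I_n * 'I_w.+1}, mu <- s]).
elim/mset_ind => [|[i m] mu _]; first by rewrite mem_head.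
rewrite mset_weightD1 in_cons => le; apply/orP; right.
have lt : (m < w.+1)%N by lia.
apply/allpairsP; exists ((i, Ordinal lt), mu); split; rewrite ?mem_enum //=.
by apply: sP; lia.
Qed.

Lemma keys_finite (d : int) : exists s : seq (lat L * {mset ('I_n * nat)}),
  forall x, key_degree x = d -> x \in s.
Proof.
(* The extra 1 accounts for the rounding in the integer quotient of (a, a) by 2. *)
have [s sP] := short_vectors_finite (`|d|.*2.+1).
have [t tP] := light_msets_finite `|d|.
exists [seq (a, mu) | a <- s, mu <- t] => -[a mu] kd.
apply/allpairsP; exists (a, mu); rewrite /key_degree /= in kd.
by have a0 := form_ge0 a; split=> //=; [apply: sP | apply: tP]; lia.
Qed.
End FinitelyManyKeys.

Lemma VL_degree_coordinates (L : evenLattice) (n : nat) (alpha : lattice_basis L n)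
    (E : central_extension L) (Y : int -> VLQ L n -> VLQ L n -> VLQ L n)
    (hY : is_lattice_va alpha E Y) (pos : positive_definite L) (d : int) :
  let H := fun v : VLQ L n => v \in VL_pred alpha /\ degQ d v in
  exists (N : nat) (g : nat -> VLQ L n) (c : nat -> VLQ L n -> int),
    [/\ forall i, H (g i), forall i, additive_on H (c i)
      & forall v, H v -> v = \sum_(i < N) g i *~ c i v].
Proof.
move=> H; have [ks ksP] := keys_finite alpha pos d.
pose f := (`|d|%N)`!; pose x0 : lat L * {mset ('I_n * nat)} := (0, mset0).
(* The floor is exact on H, where |d|! clears the denominators. *)
pose x i (v : VLQ L n) := Num.floor ((f%:R *: v)@_(nth x0 ks i)).
have xE i v : H v -> (x i v)%:~R = (f%:R *: v)@_(nth x0 ks i).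
  by move=> [vVL dv]; apply: floorK; apply: (int_coef_VL hY pos).
have HB u v : H u -> H v -> H (u - v).
  move=> [uVL du] [vVL dv]; split; first exact: rpredB.
  by apply: supportedD => //; apply: supportedN.
apply: (@subgroup_coordinates _ H x (size ks)) => //.
- by split; [exact: rpred0 | exact: supported0].
- move=> i _ u v Hu Hv; apply: (@intr_inj rat).
  transitivity ((f%:R *: (u - v))@_(nth x0 ks i)); first exact: (xE i _ (HB u v Hu Hv)).
  rewrite scalerBr mcoeffB [RHS]rmorphB.
  exact: (congr2 (fun a b => a - b) (esym (xE i _ Hu)) (esym (xE i _ Hv))).
move=> v Hv xv0; apply/malgP => k; rewrite mcoeff0.
case: (msuppP v k) => // kv; have kd : key_degree k = d by case: Hv => _; apply.
have := xE (index k ks) v Hv.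
rewrite xv0 ?index_mem ?ksP // nth_index ?ksP // mcoeffZ => /esym/eqP.
by rewrite mulf_eq0 pnatr_eq0 gtn_eqF ?fact_gt0 //= => /eqP.
Qed.

(** * Tensor products *)

Section TensorTheory.
Context {R : comPzRingType} {V : zmodType}.
Local Notation VR := (tensor R V).

Lemma tens_class_sum (s : seq (V * R)) : tens_class s = \sum_(p <- s) tens p.1 p.2.
Proof.
elim: s => [|[v r] s IH]; first by rewrite big_nil -(tens0 V (0 : R)); apply/esym/tens0.
by rewrite big_cons -IH -tens_classD.
Qed.

Lemma tens_add_ind (P : VR -> Prop) :
  (forall v r, P (tens v r)) -> (forall x y, P x -> P y -> P (x + y)) ->
  forall x, P x.
Proof.
move=> Pt PD; elim/tens_ind => s; rewrite tens_class_sum.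
by apply: big_ind => //; rewrite -(tens0 V (0 : R)).
Qed.

Lemma tensZ a v r : a *: tens v r = tens v (a * r) :> VR.
Proof. exact: tens_scaleE. Qed.

Lemma tens0r v : tens v 0 = 0 :> VR.
Proof. by rewrite -[0 in LHS](mul0r 0) -tensZ scale0r. Qed.

Lemma tensN v r : tens (- v) r = - tens v r :> VR.
Proof. by apply: (addrI (tens v r)); rewrite -tensDl !subrr tens0. Qed.

Lemma tensB u v r : tens (u - v) r = tens u r - tens v r :> VR.
Proof. by rewrite tensDl tensN. Qed.

Lemma tens_suml I (s : seq I) (P : pred I) (F : I -> V) r :
  tens (\sum_(i <- s | P i) F i) r = \sum_(i <- s | P i) tens (F i) r :> VR.
Proof.
exact: (big_morph (fun v => tens v r) (fun u v => tensDl u v r) (tens0 V r)).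
Qed.

Lemma tensMz v z r : tens (v *~ z) r = tens v (z%:~R * r) :> VR.
Proof.
have tensMn m : tens (v *+ m) r = tens v (m%:R * r) :> VR.
  elim: m => [|m IH]; first by rewrite mulr0n mul0r tens0 tens0r.
  by rewrite mulrS tensDl IH -tensDr mulrS mulrDl mul1r.
case: z => m; first exact: tensMn.
rewrite NegzE !mulrNz tensN tensMn mulNr.
by apply: (addrI (tens v (m.+1%:R * r))); rewrite subrr -tensDr subrr tens0r.
Qed.

Lemma tensMzl v z r : tens (v *~ z) r = tens v r *~ z :> VR.
Proof. by rewrite tensMz -scaler_int tensZ. Qed.

Section Elim.
Variables (M : zmodType) (h : V -> R -> M).
Hypothesis hl : forall u v r, h (u + v) r = h u r + h v r.
Hypothesis hr : forall v r s, h v (r + s) = h v r + h v s.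

(** Universal property of the tensor product: for biadditive h the chosen representative is
    immaterial by [sum_tens_rel]. *)
Definition tens_elim (x : VR) : M := \sum_(p <- repr x) h p.1 p.2.

Lemma tens_elim_class s : tens_elim (tens_class s) = \sum_(p <- s) h p.1 p.2.
Proof. by apply: sum_tens_rel => //; apply: repr_class. Qed.

Lemma tens_elimE v r : tens_elim (tens v r) = h v r.
Proof. by rewrite tens_elim_class big_seq1. Qed.

Lemma tens_elimD x y : tens_elim (x + y) = tens_elim x + tens_elim y.
Proof.
elim/tens_ind: x => s; elim/tens_ind: y => t.
by rewrite -tens_classD !tens_elim_class big_cat.
Qed.
End Elim.

Section Product.
Variable f : V -> V -> V.
Hypothesis fl : forall x y z, f (x + y) z = f x z + f y z.
Hypothesis fr : forall x y z, f z (x + y) = f z x + f z y.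

Lemma tens_prod_class s t : tens_prod f (tens_class s) (tens_class t)
  = \sum_(p <- s) \sum_(q <- t) tens (f p.1 q.1) (p.2 * q.2) :> VR.
Proof.
rewrite /tens_prod (@sum_tens_rel R V _ (fun x a => \sum_(q <- repr (tens_class t))
  tens (f x q.1) (a * q.2)) _ _ _ _ (repr_class s)); first last.
- by move=> x y z; rewrite -big_split; apply: eq_bigr => q _; rewrite mulrDl tensDr.
- by move=> x y z; rewrite -big_split; apply: eq_bigr => q _; rewrite fl tensDl.
apply: eq_bigr => p _.
apply: (@sum_tens_rel R V _ (fun y b => tens (f p.1 y) (p.2 * b)) _ _ _ _ (repr_class t)).
  by move=> x y z; rewrite fr tensDl.
by move=> x y z; rewrite mulrDr tensDr.
Qed.

Lemma tens_prod_linl a x x' y :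
  tens_prod f (a *: x + x') y = a *: tens_prod f x y + tens_prod f x' y :> VR.
Proof.
elim/tens_ind: x => s; elim/tens_ind: x' => s'; elim/tens_ind: y => t.
rewrite [a *: _]tens_scaleE -tens_classD !tens_prod_class big_cat big_map /=.
congr (_ + _); rewrite scaler_sumr; apply: eq_bigr => p _.
by rewrite scaler_sumr; apply: eq_bigr => q _; rewrite tensZ mulrA.
Qed.

Lemma tens_prod_linr a x y y' :
  tens_prod f x (a *: y + y') = a *: tens_prod f x y + tens_prod f x y' :> VR.
Proof.
elim/tens_ind: x => s; elim/tens_ind: y => t; elim/tens_ind: y' => t'.
rewrite [a *: _]tens_scaleE -tens_classD !tens_prod_class scaler_sumr -big_split.
apply: eq_bigr => p _; rewrite big_cat big_map /= scaler_sumr.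
by congr (_ + _); apply: eq_bigr => q _; rewrite tensZ mulrCA.
Qed.
End Product.
End TensorTheory.

(** * Base change *)

Section BaseChange.
Context {L : evenLattice} {n : nat}.
Variables (alpha : lattice_basis L n) (E : central_extension L).
Local Notation V := (VLQ L n).
Local Notation VLZ := (VL alpha).
Variable Y : int -> V -> V -> V.
Hypothesis hY : is_lattice_va alpha E Y.
Variable R : comPzRingType.
Local Notation VLR := (VLR alpha R).
Local Notation prodZ := (prodZ Y).
Local Notation prodR := (prodR alpha R Y).
Local Notation degR := (degR alpha R).
Let va := lva_va hY.
Implicit Types (u v w : VLZ).

Lemma VLR_ind (P : VLR -> Prop) :
  (forall v r, P (tens v r)) -> (forall x y, P x -> P y -> P (x + y)) ->
  forall x, P x.
Proof. exact: tens_add_ind. Qed.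

Lemma VL_val_inj u v : VL_val u = VL_val v -> u = v.
Proof. exact: val_inj. Qed.

Lemma VL_valD u v : VL_val (u + v) = VL_val u + VL_val v.
Proof. exact: (raddfD (val : VLZ -> V)). Qed.

Lemma VL_valB u v : VL_val (u - v) = VL_val u - VL_val v.
Proof. exact: (raddfB (val : VLZ -> V)). Qed.

Lemma VL_val_sum I (r : seq I) (P : pred I) (F : I -> VLZ) :
  VL_val (\sum_(i <- r | P i) F i) = \sum_(i <- r | P i) VL_val (F i).
Proof. exact: (raddf_sum (val : VLZ -> V)). Qed.

Lemma VL_valMz u z : VL_val (u *~ z) = VL_val u *~ z.
Proof. exact: (raddfMz (val : VLZ -> V)). Qed.

(** Closure of V_L under products is used here; identities of V_L are then checked in [VLQ] through
    the injection [VL_val]. *)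
Lemma prodZE k u v : VL_val (prodZ k u v) = Y k (VL_val u) (VL_val v).
Proof.
rewrite /Defs.prodZ; have := product_in_VL hY k (VL_valP u) (VL_valP v).
exact: insubdK.
Qed.

Lemma prodZDl k u v w : prodZ k (u + v) w = prodZ k u w + prodZ k v w.
Proof. by apply: VL_val_inj; rewrite VL_valD !prodZE VL_valD (YDl va). Qed.

Lemma prodZDr k u v w : prodZ k w (u + v) = prodZ k w u + prodZ k w v.
Proof. by apply: VL_val_inj; rewrite VL_valD !prodZE VL_valD (YDr va). Qed.

Lemma prodR_tens k u v (a b : R) : prodR k (tens u a) (tens v b)
  = tens (prodZ k u v) (a * b).
Proof. by apply: tens_prodE => x y z; rewrite ?prodZDl ?prodZDr. Qed.

Lemma prodR_linl k (w : VLR) (a : R) x x' :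
  prodR k (a *: x + x') w = a *: prodR k x w + prodR k x' w.
Proof. by apply: tens_prod_linl => y z t; rewrite ?prodZDl ?prodZDr. Qed.

Lemma prodR_linr k (w : VLR) (a : R) x x' :
  prodR k w (a *: x + x') = a *: prodR k w x + prodR k w x'.
Proof. by apply: tens_prod_linr => y z t; rewrite ?prodZDl ?prodZDr. Qed.

Lemma prodRDl k x y z : prodR k (x + y) z = prodR k x z + prodR k y z.
Proof. by rewrite -[x in LHS]scale1r prodR_linl scale1r. Qed.

Lemma prodRDr k x y z : prodR k z (x + y) = prodR k z x + prodR k z y.
Proof. by rewrite -[x in LHS]scale1r prodR_linr scale1r. Qed.

Lemma prodR0l k z : prodR k 0 z = 0.
Proof. by apply: (addrI (prodR k 0 z)); rewrite -prodRDl !addr0. Qed.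

Lemma prodR0r k z : prodR k z 0 = 0.
Proof. by apply: (addrI (prodR k z 0)); rewrite -prodRDr !addr0. Qed.

Lemma borcherdsZ r s t u v w : exists N0 : nat, forall N : nat, (N0 <= N)%N ->
  \sum_(i < N) prodZ (r + s - i%:Z) (prodZ (t + i%:Z) u v) w *~ binz r i
  = \sum_(i < N) (prodZ (r + t - i%:Z) u (prodZ (s + i%:Z) v w)
      - prodZ (s + t - i%:Z) v (prodZ (r + i%:Z) u w) *~ signz t)
      *~ ((-1) ^+ i * binz t i).
Proof.
have [N0 H] := va_borcherds va r s t (VL_val u) (VL_val v) (VL_val w).
exists N0 => N leN; apply: VL_val_inj; rewrite !VL_val_sum.
transitivity (\sum_(i < N) Y (r + s - i%:Z) (Y (t + i%:Z) (VL_val u) (VL_val v))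
  (VL_val w) *~ binz r i).
  by apply: eq_bigr => i _; rewrite VL_valMz !prodZE.
rewrite (H N leN); apply: eq_bigr => i _.
by rewrite VL_valMz VL_valB VL_valMz !prodZE.
Qed.

Definition borcherds_lhs r s t (N : nat) (x y z : VLR) : VLR :=
  \sum_(i < N) prodR (r + s - i%:Z) (prodR (t + i%:Z) x y) z *~ binz r i.

Definition borcherds_rhs r s t (N : nat) (x y z : VLR) : VLR :=
  \sum_(i < N) (prodR (r + t - i%:Z) x (prodR (s + i%:Z) y z)
      - prodR (s + t - i%:Z) y (prodR (r + i%:Z) x z) *~ signz t)
      *~ ((-1) ^+ i * binz t i).

Lemma addrB_ACA (M : zmodType) (a b c d : M) (m : int) :
  a + b - (c + d) *~ m = (a - c *~ m) + (b - d *~ m).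
Proof. by rewrite mulrzDl opprD addrACA. Qed.

(** The bound N0 depends on the vectors, so the induction over sums of pure tensors carries the
    whole existential statement and takes the larger of two bounds. *)
Lemma borcherdsR r s t x y z : exists N0 : nat, forall N : nat, (N0 <= N)%N ->
  borcherds_lhs r s t N x y z = borcherds_rhs r s t N x y z.
Proof.
pose P x y z := exists N0 : nat, forall N : nat, (N0 <= N)%N ->
  borcherds_lhs r s t N x y z = borcherds_rhs r s t N x y z.
have comb (Q1 Q2 Q3 : nat -> Prop) : (forall N, Q1 N -> Q2 N -> Q3 N) ->
   (exists N0, forall N, (N0 <= N)%N -> Q1 N) ->
   (exists N0, forall N, (N0 <= N)%N -> Q2 N) ->
   exists N0, forall N, (N0 <= N)%N -> Q3 N.
  move=> Q [N1 H1] [N2 H2]; exists (maxn N1 N2) => N; rewrite geq_max => /andP[l1 l2].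
  by apply: Q; [apply: H1 | apply: H2].
rewrite -/(P x y z); elim/VLR_ind: x => [u a|x x' Px Px'].
  elim/VLR_ind: y => [v b|y y' Py Py'].
    elim/VLR_ind: z => [w c|z z' Pz Pz'].
      have [N0 H] := borcherdsZ r s t u v w; exists N0 => N leN.
      rewrite /borcherds_lhs /borcherds_rhs.
      transitivity (tens (\sum_(i < N)
         prodZ (r + s - i%:Z) (prodZ (t + i%:Z) u v) w *~ binz r i) (a * b * c) : VLR).
        rewrite tens_suml; apply: eq_bigr => i _.
        by rewrite !prodR_tens tensMzl.
      rewrite (H N leN) tens_suml; apply: eq_bigr => i _.
      by rewrite !prodR_tens [b * (a * c)]mulrCA mulrA tensMzl tensB tensMzl.
    apply: comb Pz Pz' => N; rewrite /borcherds_lhs /borcherds_rhs => e1 e2.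
    under eq_bigr => i _ do rewrite prodRDr mulrzDl.
    rewrite big_split /= e1 e2 -big_split; apply: eq_bigr => i _ /=.
    by rewrite !prodRDr addrB_ACA mulrzDl.
  apply: comb Py Py' => N; rewrite /borcherds_lhs /borcherds_rhs => e1 e2.
  under eq_bigr => i _ do rewrite prodRDr prodRDl mulrzDl.
  rewrite big_split /= e1 e2 -big_split; apply: eq_bigr => i _ /=.
  by rewrite !(prodRDr, prodRDl) addrB_ACA mulrzDl.
apply: comb Px Px' => N; rewrite /borcherds_lhs /borcherds_rhs => e1 e2.
under eq_bigr => i _ do rewrite !prodRDl mulrzDl.
rewrite big_split /= e1 e2 -big_split; apply: eq_bigr => i _ /=.
by rewrite !(prodRDr, prodRDl) addrB_ACA mulrzDl.
Qed.

Lemma prodR_trunc x y : exists N : int, forall k : int, N <= k -> prodR k x y = 0.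
Proof.
have comb (Q1 Q2 Q3 : int -> Prop) : (forall k, Q1 k -> Q2 k -> Q3 k) ->
   (exists N : int, forall k, N <= k -> Q1 k) ->
   (exists N : int, forall k, N <= k -> Q2 k) ->
   exists N : int, forall k, N <= k -> Q3 k.
  move=> Q [N1 H1] [N2 H2]; exists (Num.max N1 N2) => k; rewrite ge_max => /andP[l1 l2].
  by apply: Q; [apply: H1 | apply: H2].
elim/VLR_ind: x => [u a|x x' Px Px']; last first.
  by apply: comb Px Px' => k e1 e2; rewrite prodRDl e1 e2 addr0.
elim/VLR_ind: y => [v b|y y' Py Py']; last first.
  by apply: comb Py Py' => k e1 e2; rewrite prodRDr e1 e2 addr0.
have [N HN] := va_trunc va (VL_val u) (VL_val v); exists N => k /HN eq0.
rewrite prodR_tens (_ : prodZ k u v = 0) ?tens0 //.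
by apply: VL_val_inj; rewrite prodZE eq0.
Qed.

Lemma prodR_vertex_algebra : vertex_algebra (vacR alpha R) prodR.
Proof.
split.
- by move=> k w a x x'; apply: prodR_linl.
- by move=> k w a x x'; apply: prodR_linr.
- exact: prodR_trunc.
- move=> k; elim/VLR_ind => [v b|x y IHx IHy]; last first.
    by rewrite prodRDr IHx IHy; case: ifP; rewrite ?addr0.
  rewrite prodR_tens mul1r (_ : prodZ k (vacZ alpha) v = if k == -1 then v else 0).
    by case: ifP; rewrite ?tens0.
  by apply: VL_val_inj; rewrite prodZE (va_vac va); case: ifP.
- elim/VLR_ind => [v b|x y IHx IHy]; last by rewrite prodRDl IHx IHy.
  rewrite prodR_tens mulr1; congr tens.
  by apply: VL_val_inj; rewrite prodZE (va_create0 va).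
- move=> x k; elim/VLR_ind: x => [v b|x y IHx IHy].
    rewrite prodR_tens (_ : prodZ k v (vacZ alpha) = 0) ?tens0 //.
    by apply: VL_val_inj; rewrite prodZE (va_create va).
  by rewrite prodRDl IHx IHy addr0.
- exact: borcherdsR.
Qed.

Lemma degR_ind d (P : VLR -> Prop) : P 0 -> (forall x y, P x -> P y -> P (x + y)) ->
  (forall v r, degQ d (VL_val v) -> P (tens v r)) -> forall x, degR d x -> P x.
Proof.
move=> P0 PD Pt _ [s [sd ->]]; rewrite big_seq; apply: big_ind => // p ps.
by apply: Pt; apply: sd.
Qed.

Lemma degR_tens d v (r : R) : degQ d (VL_val v) -> degR d (tens v r).
Proof.
move=> dv; exists [:: (v, r)]; rewrite big_seq1; split=> // p.
by rewrite inE => /eqP ->.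
Qed.

Lemma degR_submodule d : submodule (degR d).
Proof.
split; first by exists [::]; rewrite big_nil.
move=> a _ _ [s [sd ->]] [t [td ->]].
exists ([seq (p.1, a * p.2) | p <- s] ++ t); split=> [p|].
  by rewrite mem_cat => /orP[/mapP[q /sd qd ->]|/td].
rewrite big_cat big_map scaler_sumr /=; congr (_ + _).
by apply: eq_bigr => p _; rewrite tensZ.
Qed.

Lemma degRD d x y : degR d x -> degR d y -> degR d (x + y).
Proof. by rewrite -[x in X in _ -> _ -> X]scale1r; apply: (degR_submodule d).2. Qed.

Lemma degR0 d : degR d 0.
Proof. exact: (degR_submodule d).1. Qed.

Lemma degR_product d e k x y :
  degR d x -> degR e y -> degR (d + e - k - 1) (prodR k x y).
Proof.
move=> dx ey; elim/degR_ind: dx => [|x1 x2 IH1 IH2|u a du].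
- by rewrite prodR0l; apply: degR0.
- by rewrite prodRDl; apply: degRD.
elim/degR_ind: ey => [|y1 y2 IH1 IH2|v b ev].
- by rewrite prodR0r; apply: degR0.
- by rewrite prodRDr; apply: degRD.
by rewrite prodR_tens; apply: degR_tens; rewrite prodZE; apply: (product_degree hY).
Qed.

Definition deg_partZ d (v : VLZ) : VLZ := MkVL (deg_part_VL hY d (VL_valP v)).

Lemma deg_partZD d u v : deg_partZ d (u + v) = deg_partZ d u + deg_partZ d v.
Proof. 
apply: VL_val_inj; rewrite [RHS]VL_valD -[LHS]/(deg_part d (VL_val (u + v))) VL_valD.
exact: linearD.
Qed.

(** Functoriality extends the projections of V_L to the tensor product, so the sum of the pieces
    stays direct whatever the torsion of R. *)
Definition deg_partR d : VLR -> VLR := tens_elim (fun v r => tens (deg_partZ d v) r).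

Lemma deg_partR_tens d v r : deg_partR d (tens v r) = tens (deg_partZ d v) r.
Proof.
by apply: tens_elimE => [x y z|x y z]; rewrite ?deg_partZD ?tensDl ?tensDr.
Qed.

Lemma deg_partRD d x y : deg_partR d (x + y) = deg_partR d x + deg_partR d y.
Proof.
by apply: tens_elimD => [u v z|u v z]; rewrite ?deg_partZD ?tensDl ?tensDr.
Qed.

Lemma deg_partR0 d : deg_partR d 0 = 0.
Proof. by apply: (addrI (deg_partR d 0)); rewrite -deg_partRD !addr0. Qed.

Lemma deg_partR_sum d I (s : seq I) (F : I -> VLR) :
  deg_partR d (\sum_(i <- s) F i) = \sum_(i <- s) deg_partR d (F i).
Proof. exact: (big_morph (deg_partR d) (deg_partRD d) (deg_partR0 d)). Qed.

Lemma deg_partR_deg d x : degR d (deg_partR d x).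
Proof.
elim/VLR_ind: x => [v r|x y IHx IHy]; last by rewrite deg_partRD; apply: degRD.
by rewrite deg_partR_tens; apply: degR_tens; apply: deg_part_deg.
Qed.

Lemma deg_partR_id d e x : degR e x -> deg_partR d x = if e == d then x else 0.
Proof.
elim/degR_ind => [|y z IHy IHz|v r ev]; first by rewrite deg_partR0 if_same.
  by rewrite deg_partRD IHy IHz; case: ifP; rewrite ?addr0.
rewrite deg_partR_tens (_ : deg_partZ d v = if e == d then v else 0).
  by case: ifP; rewrite ?tens0.
by apply: VL_val_inj; rewrite /= (deg_part_id _ ev); case: ifP.
Qed.

(** Allowing every larger set t of degrees lets the sets of two summands be merged. *)
Lemma sum_deg_partR x : exists s : seq int, forall t : seq int, uniq t ->
  {subset s <= t} -> x = \sum_(d <- t) deg_partR d x.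
Proof.
elim/VLR_ind: x => [v r|x y [s1 H1] [s2 H2]].
  exists [seq key_degree k | k <- msupp (VL_val v)] => t ut st.
  under eq_bigr => d _ do rewrite deg_partR_tens.
  rewrite -tens_suml; congr tens; apply: VL_val_inj; rewrite VL_val_sum /=.
  exact: sum_deg_part.
exists (s1 ++ s2) => t ut st; under eq_bigr => d _ do rewrite deg_partRD.
rewrite big_split /= -H1 // -?H2 // => d ds; apply: st; rewrite mem_cat ds ?orbT //.
Qed.

Lemma degR_direct_sum : direct_sum degR.
Proof.
split=> [d|x|s f us df f0 k ks]; first exact: degR_submodule.
  have [s H] := sum_deg_partR x; exists (undup s), (fun d => deg_partR d x).
  split=> [d|]; first exact: deg_partR_deg.
  by apply: H; [apply: undup_uniq | move=> d; rewrite mem_undup].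
have := congr1 (deg_partR k) f0; rewrite deg_partR0 deg_partR_sum => <-.
rewrite (bigD1_seq k) //= (deg_partR_id _ (df k)) eqxx big1 ?addr0 // => d ne.
by rewrite (deg_partR_id _ (df d)) (negbTE ne).
Qed.

Lemma prodR_graded : graded_vertex_algebra (vacR alpha R) prodR degR.
Proof.
split; [exact: prodR_vertex_algebra | exact: degR_direct_sum | ].
by move=> k m j x y; apply: degR_product.
Qed.

(** * Bounded grading and finite projective pieces over R *)

Section Finiteness.
Hypothesis pos : positive_definite L.

Lemma degR_bounded : exists N : int, forall k, k < N -> forall x, degR k x -> x = 0.
Proof.
exists 0 => k k0 x; elim/degR_ind => [//|y z -> ->|v r kv]; first by rewrite addr0.
suff -> : v = 0 by rewrite tens0.
apply: VL_val_inj; rewrite -[VL_val 0]/(0 : V); apply/malgP => y; rewrite mcoeff0.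
case: msuppP => // /kv ky; have := form_ge0 pos y.1; lia.
Qed.

(* Each degree piece is a free module, with coordinates the base change of
   those of its integral form. *)
Lemma degR_coordinates d : exists (N : nat) (g : nat -> VLR) (c : nat -> VLR -> R),
  [/\ forall i, degR d (g i), forall i a x y, c i (a *: x + y) = a * c i x + c i y
    & forall x, degR d x -> x = \sum_(i < N) c i x *: g i].
Proof.
have [N [g [c [gH cB vE]]]] := VL_degree_coordinates hY pos d.
pose H (v : V) := v \in VL_pred alpha /\ degQ d v.
have H0 : H 0 by split; [exact: rpred0 | exact: supported0].
have HN (v : V) : H v -> H (- v).
  by move=> [vVL dv]; split; [rewrite rpredN | apply: supportedN].
have cN i (v : V) : H v -> c i (- v) = - c i v.
  by move=> Hv; rewrite -[- v]sub0r cB // (additive_on0 H0 (cB i)) sub0r.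
have cD i (u v : V) : H u -> H v -> c i (u + v) = c i u + c i v.
  by move=> Hu Hv; rewrite -{1}[v]opprK cB ?cN ?opprK //; apply: HN.
have HP v : H (deg_part d (VL_val v)).
  by split; [apply: (deg_part_VL hY); apply: VL_valP | apply: deg_part_deg].
(* Composition with the projection extends c i, additive only on the degree piece, to all of V_L, so
   that it passes to the tensor product. *)
pose h i (v : VLZ) (r : R) := (c i (deg_part d (VL_val v)))%:~R * r.
have hl i u v r : h i (u + v) r = h i u r + h i v r.
  rewrite /h (_ : deg_part d _ = deg_part d (VL_val u) + deg_part d (VL_val v)).
    by rewrite cD // rmorphD mulrDl.
  by rewrite VL_valD; exact: linearD.
have hr i v r s : h i v (r + s) = h i v r + h i v s by rewrite /h mulrDr.
exists N, (fun i => tens (MkVL (gH i).1 : VLZ) 1), (fun i => tens_elim (h i)).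
split=> [i|i a x y|x].
- by apply: degR_tens; case: (gH i).
- rewrite (tens_elimD (hl i) (hr i)); congr (_ + _).
  elim/VLR_ind: x => [v r|x z IHx IHz]; last first.
    by rewrite scalerDr !(tens_elimD (hl i) (hr i)) IHx IHz mulrDr.
  by rewrite tensZ !(tens_elimE (hl i) (hr i)) /h mulrCA.
elim/degR_ind => [|y z IHy IHz|v r dv].
- rewrite big1 // => i _; rewrite (_ : tens_elim (h i) 0 = 0) ?scale0r //.
  by apply: (addrI (tens_elim (h i) 0)); rewrite -(tens_elimD (hl i) (hr i)) !addr0.
- rewrite {1}IHy {1}IHz -big_split; apply: eq_bigr => i _ /=.
  by rewrite (tens_elimD (hl i) (hr i)) scalerDl.
have {1}-> : v = \sum_(i < N) (MkVL (gH i).1 : VLZ) *~ c i (VL_val v).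
  apply: VL_val_inj; rewrite VL_val_sum.
  rewrite [LHS](vE _ (conj (VL_valP v) dv)); apply: eq_bigr => i _.
  by rewrite VL_valMz.
rewrite tens_suml; apply: eq_bigr => i _.
rewrite (tens_elimE (hl i) (hr i)) /h (deg_part_id _ dv) eqxx tensZ mulr1.
by rewrite tensMz.
Qed.

Lemma degR_finitely_generated d : finitely_generated (degR d).
Proof.
have [N [g [c [gd _ xE]]]] := degR_coordinates d.
exists (mkseq g N); split=> [x /mapP[i _ ->] // | x /xE xN].
exists (fun i => c i x); rewrite size_mkseq {1}xN.
by apply: eq_bigr => i _; rewrite nth_mkseq.
Qed.

(** Dual basis argument: linear coordinates recombined with lifts of the images of the
    generators. *)
Lemma degR_projective d : projective (degR d).
Proof.
have [N [g [c [gd cL xE]]]] := degR_coordinates d.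
move=> M P p f p_surj f_lin.
have [e eE] := boolp.choice (fun i => p_surj (f (g i))).
exists (fun x => \sum_(i < N) c i x *: e i) => [a x y _ _|x dx].
  rewrite scaler_sumr -big_split; apply: eq_bigr => i _ /=.
  by rewrite cL scalerDl scalerA.
have f0 : f 0 = 0.
  have := f_lin 1 0 0 (degR0 d) (degR0 d); rewrite !scale1r addr0.
  by move=> /(congr1 (fun z => z - f 0)); rewrite addrK subrr => ->.
(* f is linear only on the piece, so membership of the partial sums is carried along. *)
have f_sum (a : nat -> R) m : degR d (\sum_(i < m) a i *: g i) /\
    f (\sum_(i < m) a i *: g i) = \sum_(i < m) a i *: f (g i).
  elim: m => [|m [IHd IH]]; first by rewrite !big_ord0; split=> //; apply: degR0.
  rewrite !big_ord_recr /= addrC [RHS]addrC; split; first exact: (degR_submodule d).2.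
  by rewrite f_lin // IH.
rewrite [in RHS](xE _ dx) (f_sum (fun i => c i x) N).2 linear_sum; apply: eq_bigr => i _.
by rewrite linearZ eE.
Qed.
End Finiteness.
End BaseChange.

(** * The conformal vector *)

(** Off the diagonal the factor 2 absorbs the 1/2 of omega, which leads to the form of [omegaR]. *)
Lemma sum_symmetric (n : nat) (W : zmodType) (B : 'I_n -> 'I_n -> W) :
  (forall i j, B i j = B j i) ->
  \sum_i \sum_j B i j = \sum_i B i i + \sum_(i < n) \sum_(j < n | (i < j)%N) B i j *+ 2.
Proof.
move=> Bsym.
have -> : \sum_i \sum_j B i j = \sum_i B i i
    + (\sum_(i < n) \sum_(j < n | (i < j)%N) B i j
    + \sum_(i < n) \sum_(j < n | (j < i)%N) B i j).
  rewrite -!big_split; apply: eq_bigr => i _ /=.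
  rewrite (bigD1 i) //= (bigID (fun j : 'I_n => (i < j)%N)) /=; congr (_ + (_ + _)).
    by apply: eq_bigl => j; rewrite -val_eqE /=; lia.
  by apply: eq_bigl => j; rewrite -val_eqE /=; lia.
congr (_ + _); rewrite [X in _ + X](exchange_big_dep xpredT) //= -big_split.
apply: eq_bigr => i _ /=; rewrite -big_split; apply: eq_bigr => j _ /=.
by rewrite [B j i]Bsym mulr2n.
Qed.

(** For e = D^2: of the two factors brought by the quadratic side, one makes omega integral on the
    linear side and the other enters its integer coefficient. *)
Lemma scale_int_combination (W : lmodType rat) (e m z : int) (h : rat) (x y : W) :
  e%:~R * e%:~R * h = z%:~R ->
  (e%:~R * e%:~R) *: (m%:~R *: x + h *: y) = (e%:~R *: x) *~ (m * e) + y *~ z.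
Proof.
move=> eh; rewrite scalerDr !scalerA eh [_ *: y]scaler_int; congr (_ + _).
by rewrite -[RHS]scaler_int scalerA intrM; congr (_ *: _); ring.
Qed.

Section IntegralConformalVector.
Context {L : evenLattice} {n : nat}.
Variables (alpha : lattice_basis L n) (E : central_extension L).
Local Notation V := (VLQ L n).
Local Notation VLZ := (VL alpha).
Local Notation H := (gram_inv alpha).
Local Notation D := (\det (gram alpha)).
Local Notation A := (\adj (gram alpha)).

Lemma adj_gram_sym i j : A i j = A j i.
Proof. by rewrite -[in RHS](gram_sym alpha) -trmx_adj [RHS]mxE. Qed.

Lemma gram_invE i j : H i j = (A i j)%:~R / D%:~R.
Proof.
rewrite /gram_inv /invmx gramQ_unit det_map_mx -map_mx_adj !mxE.
by rewrite mulrC.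
Qed.

(* With [x] the vector of coordinates [A i], the identity [A G A = D A] gives
   [(x, x) = D * A i i]. *)
Lemma adj_gram_even i : (2 %| D * A i i)%Z.
Proof.
have <- : form (\sum_j alpha j *~ A i j) (\sum_j alpha j *~ A i j) = D * A i i.
  have -> : D * A i i = (A *m gram alpha *m A) i i.
    by rewrite mul_adj_mx mul_scalar_mx [RHS]mxE.
  rewrite mxE form_suml; apply: eq_bigr => j _.
  rewrite formMzl formC form_suml (adj_gram_sym j i); congr (_ * _).
  by rewrite [RHS]mxE; apply: eq_bigr => k _; rewrite formMzl [gram alpha k j]mxE mulrC.
exact: form_even.
Qed.

(** The integer D^2 H_ii / 2, since H = adj(G) / D. *)
Definition half_diag i : int := (D * A i i %/ 2)%Z.

Lemma half_diagE i : half_diag i * 2 = D * A i i.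
Proof. exact: divzK (adj_gram_even i). Qed.

(** F is arbitrary because two cases occur: the vectors [heis2Q] for omega and the Gram entries for
    the charge. *)
Lemma sum_gram_inv (W : lmodType rat) (F : 'I_n -> 'I_n -> W) :
  (forall i j, F i j = F j i) ->
  (D ^+ 2)%:~R *: (\sum_i \sum_j (H i j / 2%:R) *: F i j)
  = \sum_i F i i *~ half_diag i
    + \sum_(i < n) \sum_(j < n | (i < j)%N) F i j *~ (A i j * D).
Proof.
move=> Fsym; have D0 : D%:~R != 0 :> rat by rewrite intr_eq0 det_gram_neq0.
have coef i j : (D ^+ 2)%:~R * (H i j / 2%:R) = (A i j * D)%:~R / 2%:R :> rat.
  by rewrite gram_invE !rmorphM /=; field.
rewrite scaler_sumr; under eq_bigr => i _ do rewrite scaler_sumr.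
rewrite (@sum_symmetric n W (fun i j => (D ^+ 2)%:~R *: ((H i j / 2%:R) *: F i j))).
  congr (_ + _); apply: eq_bigr => i _.
    rewrite scalerA coef [A i i * D]mulrC -half_diagE rmorphM /= mulfK //.
    by rewrite scaler_int.
  apply: eq_bigr => j _; rewrite scalerA coef -scaler_nat scalerA mulrC divfK //.
  by rewrite scaler_int.
by move=> i j; rewrite gram_inv_sym Fsym.
Qed.

Definition omegaZ : VLZ := \sum_i heis2 alpha i i *~ half_diag i
  + \sum_(i < n) \sum_(j < n | (i < j)%N) heis2 alpha i j *~ (A i j * D).

(** The central term is scaled by D^4: the sum accounts for D^2, the outer factor for the rest. *)
Definition chargeZ : int := D ^+ 2 * (\sum_i form (alpha i) (alpha i) * half_diag i
  + \sum_(i < n) \sum_(j < n | (i < j)%N) form (alpha i) (alpha j) * (A i j * D)).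

Lemma chargeZE : chargeZ%:~R = (D ^+ 4)%:~R * half_charge alpha.
Proof.
have := @sum_gram_inv rat^o (fun i j => (form (alpha i) (alpha j))%:~R).
move=> /(_ (fun i j => congr1 intr (formC _ _))) eqF.
rewrite -[4%N]/(2 + 2)%N exprD [(D ^+ 2 * D ^+ 2)%:~R]rmorphM -mulrA.
have -> : (D ^+ 2)%:~R * half_charge alpha = _ := eqF.
rewrite /chargeZ [LHS]rmorphM.
congr (_ * _); rewrite rmorphD !rmorph_sum; congr (_ + _); apply: eq_bigr => i _ /=.
  by rewrite rmorphM /= mulrzr.
by rewrite rmorph_sum; apply: eq_bigr => j _; rewrite rmorphM /= mulrzr.
Qed.

Variable Y : int -> V -> V -> V.
Hypothesis hY : is_lattice_va alpha E Y.
Let va := lva_va hY.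
Local Notation prodZ := (prodZ Y).

Lemma VL_val_omegaZ : VL_val omegaZ = (D ^+ 2)%:~R *: omegaQ alpha.
Proof.
rewrite /omegaQ sum_gram_inv => [|i j]; last exact: (heisC hY).
rewrite VL_valD !VL_val_sum; congr (_ + _); apply: eq_bigr => i _.
  by rewrite VL_valMz.
by rewrite VL_val_sum; apply: eq_bigr => j _; rewrite VL_valMz.
Qed.

Lemma virZ_deg k (v : VLZ) : degQ k (VL_val v) ->
  prodZ 1 omegaZ v = v *~ (k * D ^+ 2).
Proof.
move=> /(degQP hY) kv; apply: VL_val_inj.
rewrite (prodZE hY) VL_val_omegaZ (YZl va) kv VL_valMz scalerA -scaler_int.
by rewrite -intrM [D ^+ 2 * k]mulrC.
Qed.

Lemma virZ_translation (v : VLZ) :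
  prodZ 0 omegaZ v = prodZ (-2) v (vacZ alpha) *~ D ^+ 2.
Proof.
apply: VL_val_inj; rewrite VL_valMz !(prodZE hY) VL_val_omegaZ (YZl va).
by rewrite (vir_translation hY) scaler_int.
Qed.

Lemma virasoroZ m k (v : VLZ) :
  prodZ (m + 1) omegaZ (prodZ (k + 1) omegaZ v)
  - prodZ (k + 1) omegaZ (prodZ (m + 1) omegaZ v)
  = prodZ (m + k + 1) omegaZ v *~ ((m - k) * D ^+ 2)
    + v *~ (if m + k == 0 then binz (m + 1) 3 * chargeZ else 0).
Proof.
apply: VL_val_inj; rewrite VL_valB VL_valD !VL_valMz !(prodZE hY) VL_val_omegaZ.
rewrite !(YZl va) !(YZr va) !scalerA -scalerBr (virasoro hY).
apply: scale_int_combination; case: ifP => _; last by rewrite mulr0.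
rewrite intrM chargeZE -[4%N]/(2 + 2)%N exprD [(D ^+ 2 * D ^+ 2)%:~R]intrM.
by rewrite mulrCA !mulrA.
Qed.

Variables (R : comPzRingType) (u : R).
Hypothesis hu : D%:~R * u = 1.

(** Off the diagonal one factor u inverts D in adj(G) / D; on it a second one is needed, because
    halving relies on the evenness of D * adj(G)_ii. *)
Definition conformal_matrix : 'M[R]_n :=
  \matrix_(i, j) if i == j then (half_diag i)%:~R * u ^+ 2 else (A i j)%:~R * u ^+ 1.

Lemma det_sqr_inv r : (D ^+ 2)%:~R * (u ^+ 2 * r) = r.
Proof. by rewrite mulrA rmorphXn /= -exprMn hu expr1n mul1r. Qed.

(** Off the diagonal u = D * u^2, so all coefficients share the factor u^2. *)
Lemma omegaRE : omegaR alpha conformal_matrix = tens omegaZ (u ^+ 2).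
Proof.
rewrite /omegaR tensDl !tens_suml; congr (_ + _); apply: eq_bigr => i _.
  by rewrite mxE eqxx tensZ mulr1 tensMz.
rewrite tens_suml; apply: eq_bigr => j lt; rewrite mxE ifF; last first.
  by apply/negbTE; rewrite -val_eqE /= ltn_eqF.
rewrite tensZ mulr1 tensMz rmorphM -mulrA; congr tens; congr (_ * _).
by rewrite expr1 expr2 mulrA hu mul1r.
Qed.

Lemma omegaR_conformal : exists c : R,
  conformal_vertex_algebra (vacR alpha R) (prodR alpha R Y) (degR alpha R)
    (omegaR alpha conformal_matrix) c.
Proof.
have deg k : forall x, degR alpha R k x ->
    vir (prodR alpha R Y) (omegaR alpha conformal_matrix) 0 x = k%:~R *: x.
  rewrite /vir add0r omegaRE; apply: degR_ind => [|x1 x2 IH1 IH2|v r kv].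
  - by rewrite (prodR0r hY) scaler0.
  - by rewrite (prodRDr hY) IH1 IH2 scalerDr.
  by rewrite (prodR_tens hY) (virZ_deg kv) tensMz tensZ rmorphM -mulrA det_sqr_inv.
(* The integer D^4 [half_charge], with D^4 undone by u^4. *)
exists (chargeZ%:~R * u ^+ 4); split.
- exact: prodR_graded hY R.
- move=> x; have [_ /(_ x)[s [f [fd ->]]] _] := degR_direct_sum hY R.
  exists [seq (k, f k) | k <- s]; rewrite big_map; split=> // p /mapP[k _ ->].
  exact: deg.
- exact: deg.
- move=> x; rewrite /vir addNr omegaRE; move: x; apply: VLR_ind => [v r|x1 x2 IH1 IH2].
    rewrite !(prodR_tens hY) virZ_translation tensMz det_sqr_inv.
    by rewrite mulr1.
  by rewrite (prodRDr hY) (prodRDl hY) IH1 IH2.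
move=> m k x; rewrite /vir omegaRE; move: x; apply: VLR_ind => [v r|x1 x2 IH1 IH2].
  rewrite !(prodR_tens hY) -tensB virasoroZ tensDl tensMz tensMz !tensZ.
  congr (_ + _); first by rewrite rmorphM -mulrA det_sqr_inv.
  case: ifP => _; last by rewrite mul0r tens0r.
  rewrite rmorphM -[4%N]/(2 + 2)%N exprD; congr tens.
  by rewrite -!mulrA.
rewrite !(prodRDr hY) opprD addrACA IH1 IH2 scalerDr addrACA; congr (_ + _).
by case: ifP; rewrite ?scalerDr ?addr0.
Qed.
End IntegralConformalVector.

Theorem corollary1p2p10 (L : evenLattice) (n : nat) (alpha : lattice_basis L n)
    (E : central_extension L) (Y : int -> VLQ L n -> VLQ L n -> VLQ L n)
    (hY : is_lattice_va alpha E Y)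
    (R : comPzRingType) (u : R) (hu : (\det (gram alpha))%:~R * u = 1) :
  exists C : 'M[R]_n,
    [/\ forall i : 'I_n,
          loc_image (\det (gram alpha)) u
            (gram_inv alpha i i / 2%:R) (C i i),
        forall i j : 'I_n, (i < j)%N ->
          loc_image (\det (gram alpha)) u (gram_inv alpha i j) (C i j)
      & exists c : R,
          conformal_vertex_algebra (vacR alpha R) (prodR alpha R Y)
            (degR alpha R) (omegaR alpha C) c
          /\ (positive_definite L ->
              vertex_operator_algebra (vacR alpha R) (prodR alpha R Y)
                (degR alpha R) (omegaR alpha C) c)].
Proof.
have D0 : (\det (gram alpha))%:~R != 0 :> rat by rewrite intr_eq0 det_gram_neq0.
exists (conformal_matrix alpha u); split=> [i|i j lt|].
- exists (half_diag alpha i), 2%N; rewrite mxE eqxx; split=> //.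
  apply: (@mulIf _ 2%:R) => //; rewrite -[2%:R in RHS]/(2%:~R) -rmorphM half_diagE.
  by rewrite gram_invE rmorphM /=; field.
- exists ((\adj (gram alpha)) i j), 1%N; rewrite [conformal_matrix alpha u i j]mxE ifF.
    by split=> //; rewrite gram_invE expr1 divfK.
  by apply/negbTE; rewrite -val_eqE /= ltn_eqF.
have [c cva] := omegaR_conformal hY hu; exists c; split=> // pos; split=> //.
- exact: degR_bounded pos.
- exact: degR_finitely_generated hY R pos.
exact: degR_projective hY R pos.
Qed.
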